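(* Let $m \geq 3$ be an integer and let $\mathbb{CP}^m$ be the complex projective space of complex dimension $m$, equipped with the standard Fubini-Study metric $g_{FS}$. Then $(\mathbb{CP}^m, g_{FS})$ admits no orthogonal system of coordinates; that is, there is no non-empty open subset $\mathcal{U} \subset \mathbb{CP}^m$ carrying a system of orthogonal coordinates for $g_{FS}$.
   Context: Let $(M,g)$ be a Riemannian manifold of dimension $n$. A system of (real, smooth) local coordinates $x_1, \ldots, x_n$ defined on an open set $\mathcal{U} \subset M$ is called orthogonal if $g\left(\frac{\partial}{\partial x_i}, \frac{\partial}{\partial x_j}\right) = 0$ on $\mathcal{U}$ whenever $i \neq j$, i.e. if on $\mathcal{U}$ the metric has the form $g = \sum_{j=1}^n a_j^2\, dx_j \otimes dx_j$ for some positive functions $a_1, \ldots, a_n$ on $\mathcal{U}$. The Fubini-Study metric $g_{FS}$ on $\mathbb{CP}^m$ (a real manifold of dimension $n = 2m$) is the standard Kähler metric of constant holomorphic sectional curvature $c > 0$; up to a positive constant factor it is the metric making the Hopf fibration $\mathbb{S}^{2m+1} \to \mathbb{CP}^m$ from the round unit sphere a Riemannian submersion. With $J$ the complex structure of $\mathbb{CP}^m$, $\omega = g_{FS}(J\cdot, \cdot)$ the Kähler form, and the sign convention $R_{X,Y}Z = \nabla_{[X,Y]}Z - \nabla_X(\nabla_Y Z) + \nabla_Y(\nabla_X Z)$ ($\nabla$ being the Levi-Civita connection), its curvature is $$R^{FS}_{X,Y}Z = \frac{c}{4}\big(g_{FS}(X,Z)\,Y - g_{FS}(Y,Z)\,X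 + \omega(X,Z)\,JY - \omega(Y,Z)\,JX + 2\omega(X,Y)\,JZ\big).$$ *)

(* Defs.v *)
From HB Require Import structures.
From mathcomp Require Import all_boot all_order all_algebra.
From mathcomp Require Import all_classical all_reals all_analysis.
From mathcomp Require Import complex.
Set Implicit Arguments.
Unset Strict Implicit.
Unset Printing Implicit Defensive.
Import Order.TTheory GRing.Theory Num.Theory.
Import numFieldNormedType.Exports.
Local Open Scope classical_set_scope.
Local Open Scope ring_scope.

Section SmoothFunctions.
Variables (R : realType) (V W : normedModType R).

(* In finite dimension, f is C^(k+1) on the open set U iff it is differentiable
   on U with all its directional derivatives C^k on U. *)
Fixpoint Ck (k : nat) (U : set V) (f : V -> W) : Prop :=
  if k is k'.+1 then
    (forall x, U x -> differentiable f x) /\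
    (forall v, Ck k' U (fun x => 'D_v f x))
  else forall x, U x -> {for x, continuous f}.

Definition smooth_on (U : set V) (f : V -> W) : Prop := forall k, Ck k U f.

End SmoothFunctions.

Section Manifolds.
Variables (R : realType) (n : nat) (M : topologicalType).

(* The values of [chart_coord] off [chart_dom], and of [chart_param] off
   [chart_coord @` chart_dom], are irrelevant. *)
Record chart := Chart {
  chart_dom : set M;
  chart_coord : M -> 'rV[R]_n;
  chart_param : 'rV[R]_n -> M }.

Definition is_chart (x : chart) : Prop :=
  [/\ open (chart_dom x), open (chart_coord x @` chart_dom x),
      {in chart_dom x, cancel (chart_coord x) (chart_param x)},
      {in chart_dom x, continuous (chart_coord x)} &
      {in chart_coord x @` chart_dom x, continuous (chart_param x)}].

Definition smooth_transition (x y : chart) : Prop :=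
  smooth_on (chart_coord x @` (chart_dom x `&` chart_dom y))
            (chart_coord y \o chart_param x).

Definition local_coordinates (atlas : set chart) (x : chart) : Prop :=
  is_chart x /\
  forall y, atlas y -> smooth_transition x y /\ smooth_transition y x.

(* A tangent vector at p is the family of its components in all the systems of
   local coordinates around p; the values at other charts are irrelevant. *)
Definition tangent_vector := chart -> 'rV[R]_n.

Definition coordinate_vector (x : chart) (i : 'I_n) (p : M) : tangent_vector :=
  fun y =>
    'D_(delta_mx 0 i) (chart_coord y \o chart_param x) (chart_coord x p).

Definition metric := M -> tangent_vector -> tangent_vector -> R.

Definition orthogonal_coordinates
    (atlas : set chart) (g : metric) (x : chart) : Prop :=
  local_coordinates atlas x /\
  forall p, chart_dom x p -> forall i j : 'I_n, i != j ->
    g p (coordinate_vector x i p) (coordinate_vector x j p) = 0.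

End Manifolds.

Section ProjectiveSpace.
Variables (R : realType) (m : nat).

(* C^(m+1) as a real normed space: (a, b) stands for a + ib. *)
Definition realC := ('rV[R]_m.+1 * 'rV[R]_m.+1)%type.

Definition toC (z : realC) : 'rV[R[i]]_m.+1 :=
  \row_j (z.1 0 j +i* z.2 0 j)%C.

Definition mulI (z : realC) : realC := (- z.2, z.1).

(* the real part of the standard Hermitian product *)
Definition dot (z w : realC) : R :=
  \sum_j (z.1 0 j * w.1 0 j + z.2 0 j * w.2 0 j).

Record CP := MkCP {
  line : {vspace 'rV[R[i]]_m.+1};
  _ : \dim line == 1%N }.

HB.instance Definition _ := [isSub for line].
HB.instance Definition _ := [Choice of CP by <:].

Lemma dim_line0 : \dim <[delta_mx 0%R 0%R : 'rV[R[i]]_m.+1]>%VS == 1%N.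
Proof.
rewrite dim_vline; case: (delta_mx _ _ =P _) => // /matrixP /(_ 0 0).
by rewrite !mxE eqxx => /eqP; rewrite oner_eq0.
Qed.

Definition line0 : CP := MkCP dim_line0.

(* The complex line spanned by z; the value line0 at z = 0 is irrelevant. *)
Definition cp_proj (z : realC) : CP := insubd line0 <[toC z]>%VS.

(* the quotient topology of C^(m+1) \ {0} *)
Definition CP_open (U : set CP) : Prop :=
  open (cp_proj @^-1` U `&` [set z : realC | z != 0]).

Lemma CP_openT : CP_open setT.
Proof.
rewrite /CP_open preimage_setT setTI.
have -> : [set z : realC | z != 0] = ~` [set 0].
  by apply/seteqP; split => z /= /eqP.
by apply: closed_openC; apply: accessible_closed_set1;
  apply: hausdorff_accessible; apply: norm_hausdorff.
Qed.

Lemma CP_openI (A B : set CP) : CP_open A -> CP_open B -> CP_open (A `&` B).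
Proof.
by move=> oA oB; rewrite /CP_open preimage_setI setIIl; apply: openI.
Qed.

Lemma CP_open_bigU (I : Type) (F : I -> set CP) :
  (forall i, CP_open (F i)) -> CP_open (\bigcup_i F i).
Proof.
move=> oF; rewrite /CP_open preimage_bigcup setI_bigcupl.
by apply: bigcup_open => i _; apply: oF.
Qed.

HB.instance Definition _ :=
  isOpenTopological.Build CP CP_openT CP_openI CP_open_bigU.

(* [z_0 : ... : z_m] |-> (z_j / z_k)_(j <> k), with C^m identified with
   R^(m+m) by separating real and imaginary parts *)
Definition affine_chart (k : 'I_m.+1) : chart R (m + m) CP :=
  let z (p : CP) := vpick (line p) in
  let w p (j : 'I_m) := z p 0 (lift k j) / z p 0 k in
  {| chart_dom := [set p | z p 0 k != 0];
     chart_coord := fun p => row_mx (\row_j complex.Re (w p j))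
                                    (\row_j complex.Im (w p j));
     chart_param := fun u =>
       cp_proj (\row_i (if unlift k i is Some j then lsubmx u 0 j else 1),
             \row_i (if unlift k i is Some j then rsubmx u 0 j else 0)) |}.

Definition CP_atlas : set (chart R (m + m) CP) := range affine_chart.

(* A point of the unit sphere S^(2m+1) in the Hopf fibre over p. *)
Definition unit_rep (p : CP) : realC :=
  xget 0 [set z : realC | dot z z = 1 /\ cp_proj z = p].

(* u is tangent to the unit sphere at z and orthogonal to the Hopf fibre, whose
   tangent line at z is spanned by iz. *)
Definition horizontal (z u : realC) : Prop :=
  dot z u = 0 /\ dot (mulI z) u = 0.

(* the image of u by the differential of cp_proj at z *)
Definition dproj (z u : realC) : tangent_vector R (m + m) CP :=
  fun x => 'D_u (chart_coord x \o cp_proj) z.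

Definition horizontal_lift (z : realC) (v : tangent_vector R (m + m) CP)
    : realC :=
  xget 0 [set u | horizontal z u /\
    forall x, local_coordinates CP_atlas x -> chart_dom x (cp_proj z) ->
      dproj z u x = v x].

(* The metric for which the Hopf fibration of the unit sphere is a Riemannian
   submersion has holomorphic sectional curvature 4; the factor 4 / c turns it
   into the one of holomorphic sectional curvature c. *)
Definition fubini_study (c : R) : metric R (m + m) CP :=
  fun p v w =>
    let z := unit_rep p in
    4 / c * dot (horizontal_lift z v) (horizontal_lift z w).

End ProjectiveSpace.

(* Main.v *)
(** Near a point p of an orthogonal coordinate system choose a smooth lift E of
    the coordinates to C^(m+1) such that the Hermitian product of E with
    n = E(p) is constant. The Fubini-Study metric is then, up to a positive
    factor, [|E|^2 Re<E_i, E_j> - Re(<E_i, E> <E, E_j>)], where E_i denotes the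
    i-th partial derivative, so this expression vanishes for i <> j. As E - n
    vanishes at p, its derivatives of order 0, 1 and 2 at p say in turn, for
    distinct indices: the E_i are orthogonal; E_ij is a real combination of E_i
    and E_j; and, with om_ij = Re<iE_i, E_j>, the products om_ij om_kl are
    totally antisymmetric in i, j, k, l (this is the vanishing of the curvature
    components R_ijkl).
    In the graph of the pairs with om_ij <> 0, two disjoint edges therefore span
    a complete subgraph on 4 vertices. As om is nondegenerate and m >= 3, there
    are two disjoint edges and a fifth vertex adjacent to all four vertices of
    the complete subgraph they span; three of the antisymmetry relations on
    these five vertices multiply to 1 = -1. *)

Require Import Defs.
From HB Require Import structures.
From mathcomp Require Import all_boot all_order all_algebra.
From mathcomp Require Import all_classical all_reals all_analysis.
From mathcomp Require Import complex.
From mathcomp Require Import ring lra zify.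
Import Order.TTheory GRing.Theory Num.Theory.
Import numFieldNormedType.Exports.
Local Open Scope classical_set_scope.
Local Open Scope ring_scope.

Set Implicit Arguments.
Unset Strict Implicit.
Unset Printing Implicit Defensive.

(** * Smooth functions *)

Section Calculus.
Context {R : realType} {V : normedModType R}.

Lemma derive_linear (W W' : normedModType R) (L : {linear W -> W'})
    (f : V -> W) x :
    continuous L -> differentiable f x ->
  differentiable (L \o f) x /\ forall v, 'D_v (L \o f) x = L ('D_v f x).
Proof.
move=> cL df.
have dL y : differentiable (L : W -> W') y by exact: linear_differentiable.
have dLf : differentiable (L \o f) x by exact: differentiable_comp.
split=> // v; rewrite !deriveE // (diff_comp df (dL _)) /=.
by rewrite (diff_lin (f x) cL).
Qed.

(** Continuity and the product rule of a bilinear map, stated as a property so that real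
    multiplication and [dot] share one calculus. *)
Definition leibniz {W1 W2 W3 : normedModType R} (B : W1 -> W2 -> W3) : Prop :=
  (forall (f : V -> W1) (g : V -> W2) x,
     {for x, continuous f} -> {for x, continuous g} ->
     {for x, continuous (fun y => B (f y) (g y))}) /\
  (forall (f : V -> W1) (g : V -> W2) x,
     differentiable f x -> differentiable g x ->
     differentiable (fun y => B (f y) (g y)) x /\
     forall v, 'D_v (fun y => B (f y) (g y)) x =
               B ('D_v f x) (g x) + B (f x) ('D_v g x)).

Lemma leibniz_mul : leibniz (fun a b : R => a * b).
Proof.
split=> f g x; first by move=> cf cg; exact: cvgM.
move=> df dg; split=> [|v]; first exact: differentiableM.
rewrite (@deriveM _ _ f g); try exact: diff_derivable.
by rewrite /GRing.scale /= addrC [X in X + _]mulrC.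
Qed.

Lemma leibniz_sum (W1 W2 W3 : normedModType R) (I : finType)
    (B : I -> W1 -> W2 -> W3) :
  (forall i, leibniz (B i)) -> leibniz (fun a b => \sum_i B i a b).
Proof.
move=> lB; elim: (index_enum I) => [|i r [IH1 IH2]].
  have -> : (fun a b => \sum_(i <- [::]) B i a b) = fun _ _ => 0.
    by apply/funext => a; apply/funext => b; rewrite big_nil.
  split=> f g x; first by move=> _ _; exact: cst_continuous.
  move=> _ _; split=> [|v]; first exact: differentiable_cst.
  by rewrite derive_cst addr0.
have -> : (fun a b => \sum_(j <- i :: r) B j a b) =
          fun a b => B i a b + \sum_(j <- r) B j a b.
  by apply/funext => a; apply/funext => b; rewrite big_cons.
have [B1 B2] := lB i; split=> f g x.
  by move=> cf cg; apply: cvgD; [exact: B1|exact: IH1].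
move=> df dg; have [d1 D1] := B2 _ _ _ df dg; have [d2 D2] := IH2 _ _ _ df dg.
split=> [|v]; first exact: differentiableD.
rewrite (@deriveD _ _ _ (fun y => B i (f y) (g y))); try exact: diff_derivable.
by rewrite D1 D2 addrACA.
Qed.

Lemma leibniz_linear (W1 W2 W3 W1' W2' : normedModType R)
    (B : W1 -> W2 -> W3) (L1 : {linear W1' -> W1}) (L2 : {linear W2' -> W2}) :
  continuous L1 -> continuous L2 -> leibniz B ->
  leibniz (fun a b => B (L1 a) (L2 b)).
Proof.
move=> c1 c2 [B1 B2]; split=> f g x.
  move=> cf cg; apply: (B1 (L1 \o f) (L2 \o g)).
    by apply: continuous_comp => //; exact: c1.
  by apply: continuous_comp => //; exact: c2.
move=> df dg; have [d1 D1] := derive_linear c1 df.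
have [d2 D2] := derive_linear c2 dg; have [d D] := B2 _ _ _ d1 d2.
by split=> // v; rewrite D D1 D2.
Qed.

(** Differentiability is local: near [x] the first-order expansion of [f] is also one of [g], and
    uniqueness of the differential turns that expansion into differentiability. *)
Lemma near_eq_differentiable (W : normedModType R) (f g : V -> W) x :
  (\near x, f x = g x) -> differentiable f x -> differentiable g x.
Proof.
move=> fg df; have fgx : f x = g x by exact: (nbhs_singleton fg).
have H : continuous ('d f x) /\ g \o shift x = cst (g x) + 'd f x +o_ 0 id.
  split; first exact: diff_continuous.
  apply/eqaddoP => e e0.
  have /eqaddoP/(_ e e0) := diff_locally df.
  move=> H; near=> h.
  have -> : (g \o shift x - (cst (g x) + 'd f x)) h =
            (f \o shift x - (cst (f x) + 'd f x)) h.
    rewrite /= -fgx; congr (_ - _) => /=.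
    by near: h; move: fg; rewrite (near_shift 0); apply: filterS => y /=;
      rewrite subr0 => ->.
  near: h; exact: H.
apply/diff_locallyP; have E := diff_unique H.1 H.2.
by rewrite E.
Unshelve. all: by end_near. Qed.

Section Ck.
Context {W : normedModType R} (U : set V) (oU : open U).

Lemma near_open_eq (f g : V -> W) x :
  (forall y, U y -> f y = g y) -> U x -> \near x, f x = g x.
Proof.
move=> fg Ux; have := open_nbhs_nbhs (conj oU Ux); apply: filterS => y.
exact: fg.
Qed.

Lemma derive_eq_on (f g : V -> W) x v :
  (forall y, U y -> f y = g y) -> U x -> 'D_v f x = 'D_v g x.
Proof. by move=> fg Ux; apply/near_eq_derive/near_open_eq. Qed.

Lemma Ck_ext k (f g : V -> W) :
  (forall x, U x -> f x = g x) -> Ck k U f -> Ck k U g.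
Proof.
elim: k f g => [|k IH] f g fg /=.
  move=> cf x Ux; rewrite /= /prop_for /continuous_at -(fg _ Ux).
  apply: cvg_trans (cf x Ux); apply: near_eq_cvg.
  exact: near_open_eq.
move=> [df Df]; split=> [x Ux|v].
  exact: (near_eq_differentiable (near_open_eq fg Ux) (df x Ux)).
by apply: IH (Df v) => x Ux; exact: derive_eq_on.
Qed.

Lemma CkW k (f : V -> W) : Ck k.+1 U f -> Ck k U f.
Proof.
elim: k f => [|k IH] f [df Df].
  by move=> x Ux; exact: differentiable_continuous (df x Ux).
by split=> // v; exact/IH/Df.
Qed.

Lemma CkD k (f g : V -> W) :
  Ck k U f -> Ck k U g -> Ck k U (fun x => f x + g x).
Proof.
elim: k f g => [|k IH] f g.
  by move=> cf cg x Ux; apply: cvgD; [exact: cf|exact: cg].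
move=> [df Df] [dg Dg]; split=> [x Ux|v].
  by apply: differentiableD; [exact: df|exact: dg].
apply: Ck_ext (IH _ _ (Df v) (Dg v)) => x Ux.
by rewrite (@deriveD _ _ _ f g) //; apply: diff_derivable;
  [exact: df|exact: dg].
Qed.

Lemma Ck_cst k (a : W) : Ck k U (cst a).
Proof.
elim: k a => [|k IH] a; first by move=> x _; exact: cst_continuous.
split=> [x Ux|v]; first exact: differentiable_cst.
by apply: Ck_ext (IH 0) => x _; rewrite derive_cst.
Qed.

Lemma smooth_cst (a : W) : smooth_on U (cst a).
Proof. by move=> k; exact: Ck_cst. Qed.

Lemma smooth_derive (f : V -> W) v :
  smooth_on U f -> smooth_on U (fun x => 'D_v f x).
Proof. by move=> sf k; case: (sf k.+1) => _; apply. Qed.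

Lemma smooth_differentiable (f : V -> W) x :
  smooth_on U f -> U x -> differentiable f x.
Proof. by move=> /(_ 1%N)[+ _]; apply. Qed.

Lemma smooth_ext (f g : V -> W) :
  (forall x, U x -> f x = g x) -> smooth_on U f -> smooth_on U g.
Proof. by move=> fg sf k; apply: Ck_ext fg (sf k). Qed.

Lemma smoothD (f g : V -> W) :
  smooth_on U f -> smooth_on U g -> smooth_on U (fun x => f x + g x).
Proof. by move=> sf sg k; exact: CkD. Qed.

Lemma smooth_sum n (f : 'I_n -> V -> W) :
  (forall i, smooth_on U (f i)) -> smooth_on U (fun x => \sum_i f i x).
Proof.
elim: n f => [|n IH] f sf.
  by apply: (smooth_ext _ (smooth_cst 0)) => x _; rewrite big_ord0.
have := smoothD (sf ord0) (IH _ (fun i => sf (lift ord0 i))).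
by apply: smooth_ext => x _; rewrite big_ord_recl.
Qed.

Lemma smooth_subset (U' : set V) (f : V -> W) :
  U' `<=` U -> smooth_on U f -> smooth_on U' f.
Proof.
move=> U'U sf k; have {sf} := sf k; elim: k f => [|k IH] f.
  by move=> cf x /U'U; exact: cf.
by move=> [df Df]; split=> [x /U'U|v]; [exact: df|exact: (IH _ (Df v))].
Qed.

End Ck.

Section CkOps.
Context (U : set V) (oU : open U).

(** Induction on [k]: the derivative is a sum of two [B] terms, each with one differentiated factor
    and one original factor, the latter lowered by one order through [CkW]. *)
Lemma Ck_leibniz (W1 W2 W3 : normedModType R) (B : W1 -> W2 -> W3) k f g :
  leibniz B -> Ck k U f -> Ck k U g -> Ck k U (fun x => B (f x) (g x)).
Proof.
move=> [cB dB]; elim: k f g => [|k IH] f g.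
  by move=> cf cg x Ux; apply: cB; [exact: cf|exact: cg].
move=> Cf Cg; have [df Df] := Cf; have [dg Dg] := Cg; split=> [x Ux|v].
  by have [] := dB _ _ _ (df x Ux) (dg x Ux).
apply: (Ck_ext oU _ (CkD oU (IH _ _ (Df v) (CkW Cg)) (IH _ _ (CkW Cf) (Dg v)))).
by move=> x Ux; have [_ ->] := dB _ _ _ (df x Ux) (dg x Ux).
Qed.

Lemma smooth_leibniz (W1 W2 W3 : normedModType R) (B : W1 -> W2 -> W3) f g :
  leibniz B -> smooth_on U f -> smooth_on U g ->
  smooth_on U (fun x => B (f x) (g x)).
Proof. by move=> lB sf sg k; exact: Ck_leibniz. Qed.

Lemma smooth_mul (f g : V -> R) :
  smooth_on U f -> smooth_on U g -> smooth_on U (fun x => f x * g x).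
Proof. exact: (smooth_leibniz leibniz_mul). Qed.

Lemma derive_leibniz (W1 W2 W3 : normedModType R) (B : W1 -> W2 -> W3) f g x v :
  leibniz B -> smooth_on U f -> smooth_on U g -> U x ->
  'D_v (fun y => B (f y) (g y)) x = B ('D_v f x) (g x) + B (f x) ('D_v g x).
Proof.
move=> [_ dB] sf sg Ux.
by have [_ ->] := dB _ _ _ (smooth_differentiable sf Ux)
                           (smooth_differentiable sg Ux).
Qed.

Lemma smooth_deriveD (W : normedModType R) (f g : V -> W) x v :
  smooth_on U f -> smooth_on U g -> U x ->
  'D_v (fun y => f y + g y) x = 'D_v f x + 'D_v g x.
Proof.
move=> sf sg Ux.
have df := smooth_differentiable sf Ux; have dg := smooth_differentiable sg Ux.
by rewrite (@deriveD _ _ _ f g) //; exact: diff_derivable.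
Qed.

Lemma smooth_linear (W W' : normedModType R) (L : {linear W -> W'}) f :
  continuous L -> smooth_on U f -> smooth_on U (L \o f).
Proof.
move=> cL sf k; have {sf} := sf k; elim: k f => [|k IH] f.
  by move=> cf x Ux; apply: continuous_comp; [exact: cf|exact: cL].
move=> [df Df]; split=> [x Ux|v];
  first by have [] := derive_linear cL (df x Ux).
apply: Ck_ext (IH _ (Df v)) => // x Ux.
by have [_ ->] := derive_linear cL (df x Ux).
Qed.

(** The derivative of the inverse is minus the derivative of [f] times two copies of the inverse,
    which are of order [k] by induction; so the order rises by one. *)
Lemma smooth_inv (f : V -> R) :
  (forall x, U x -> f x != 0) -> smooth_on U f ->
  smooth_on U (fun x => (f x)^-1).
Proof.
move=> f0 sf; elim=> [|k IH].
  move=> x Ux; apply: cvgV; first exact: f0.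
  exact: differentiable_continuous (smooth_differentiable sf Ux).
have df x : U x -> differentiable f x by exact: smooth_differentiable.
split=> [x Ux|v]; first by apply: differentiableV; [exact: df|exact: f0].
have sDf : Ck k U (fun x => 'D_v f x) by exact: smooth_derive.
have := Ck_leibniz leibniz_mul (Ck_leibniz leibniz_mul IH IH)
          (Ck_leibniz leibniz_mul (Ck_cst oU k (-1 : R)) sDf).
apply: Ck_ext => // x Ux; rewrite (@deriveV _ _ f) ?f0 //.
  by rewrite /GRing.scale /= -expr2 exprVn; ring.
exact/diff_derivable/df.
Qed.

End CkOps.

(** * Mean values and symmetry of second derivatives *)

Lemma is_derive_line (f : V -> R) y w t :
  differentiable f (t *: w + y) ->
  is_derive t 1 (fun s : R => f (s *: w + y)) ('D_w f (t *: w + y)).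
Proof.
move=> df; pose g (s : R) := s *: w + y.
have dg : is_diff t g (fun s => s *: w).
  by apply: is_diff_eq; rewrite funeqE => s /=; rewrite addr0.
have dfg : differentiable (f \o g) t by exact: differentiable_comp.
apply: DeriveDef; first exact: diff_derivable.
rewrite (deriveE _ dfg) deriveE // diff_comp //= diff_val.
by rewrite scale1r.
Qed.

Lemma MVT_line (f : V -> R) y w s :
    0 < s ->
    (forall t, 0 <= t <= s -> differentiable f (t *: w + y)) ->
  exists2 t, 0 <= t <= s & f (s *: w + y) - f y = s * 'D_w f (t *: w + y).
Proof.
move=> s0 df.
have D t : 0 <= t <= s ->
    is_derive t 1 (fun r : R => f (r *: w + y)) ('D_w f (t *: w + y)).
  by move=> ts; apply/is_derive_line/df.
have [||t] := @MVT R (fun r => f (r *: w + y)) (fun r => 'D_w f (r *: w + y)) _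
  _ s0.
- by move=> t; rewrite in_itv /= => /andP[/ltW t0 /ltW ts]; apply: D;
  rewrite t0.
- apply: derivable_within_continuous => t; rewrite in_itv /= => ts.
  by have [] := D _ ts.
rewrite in_itv /= => /andP[/ltW t0 /ltW ts] E; exists t; first by rewrite t0.
by move: E; rewrite scale0r add0r subr0 mulrC.
Qed.

(** The second difference of [f] over the parallelogram with sides [s v] and [s w] is the increment
    along [v] of [g y = f (s w + y) - f y]. One mean value along [v], then one along [w] applied to
    ['D_v f], yields the mixed derivative. *)
Lemma mixed_MVT (f : V -> R) x v w s :
    0 < s ->
    (forall a b, 0 <= a <= s -> 0 <= b <= s ->
       differentiable f (a *: v + (b *: w + x)) /\
       differentiable (fun y => 'D_v f y) (a *: v + (b *: w + x))) ->
  exists a b, [/\ 0 <= a <= s, 0 <= b <= s &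
    f (s *: v + (s *: w + x)) - f (s *: w + x) - f (s *: v + x) + f x =
    s * s * 'D_w (fun y => 'D_v f y) (a *: v + (b *: w + x))].
Proof.
move=> s0 df; have s01 : 0 <= s <= s by rewrite lexx ltW.
have s00 : (0 : R) <= 0 <= s by rewrite lexx ltW.
pose g y := f (s *: w + y) - f y.
have shiftE (t : R) y : t *: w + (y + x) = y + (t *: w + x) by rewrite addrCA.
have dfs y : differentiable f (s *: w + y) ->
    differentiable (fun y => f (s *: w + y)) y /\
    'D_v (fun y => f (s *: w + y)) y = 'D_v f (s *: w + y).
  move=> dfy; have dsh : is_diff y (fun y => s *: w + y) id.
    by apply: is_diff_eq; rewrite funeqE => z /=; rewrite add0r.
  have dc : differentiable (f \o (fun y => s *: w + y)) y.
    exact: differentiable_comp.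
  split; first exact: dc.
  by rewrite (deriveE _ dc) (deriveE _ dfy) diff_comp //= diff_val.
have dg a : 0 <= a <= s -> differentiable g (a *: v + x) /\
    'D_v g (a *: v + x) = 'D_v f (a *: v + (s *: w + x)) - 'D_v f (a *: v + x).
  move=> as0; have [d1 _] := df _ _ as0 s01; have [d2 _] := df _ _ as0 s00.
  rewrite scale0r add0r in d2; rewrite -shiftE in d1.
  have [d3 d4] := dfs _ d1; rewrite -shiftE -d4; split.
    exact: differentiableB.
  by rewrite (@deriveB _ _ _ _ f) //; exact: diff_derivable.
have [a as0 Ea] := MVT_line s0 (fun a as0 => (dg a as0).1).
have [|b bs0 Eb] := @MVT_line (fun y => 'D_v f y) (a *: v + x) w s s0.
  by move=> b bs0; rewrite shiftE; have [] := df _ _ as0 bs0.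
exists a, b; split; [exact: as0|exact: bs0|have [_ Ec] := dg _ as0].
rewrite (shiftE b (a *: v)) (shiftE s (a *: v)) -Ec in Eb.
rewrite /g (shiftE s (s *: v)) in Ea.
have -> (C : R) : s * s * C = s * (s * C) by rewrite mulrA.
rewrite -Eb -Ea; ring.
Qed.

(** Schwarz's theorem. The same second difference is [s^2] times either mixed derivative at points
    close to [x]; continuity of both at [x] then rules out a gap between their values. *)
Lemma derive_symmetric (U : set V) (f : V -> R) x v w :
  open U -> smooth_on U f -> U x ->
  'D_v (fun y => 'D_w f y) x = 'D_w (fun y => 'D_v f y) x.
Proof.
move=> oU sf Ux; set a := 'D_v _ x; set b := 'D_w _ x.
apply/eqP/negP => /negP neq.
(* Half of the supposed gap: two errors below [e] cannot bridge it. *)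
pose e := `|a - b| / 2; have e0 : 0 < e.
  by rewrite divr_gt0 // normr_gt0 subr_eq0.
have cont v1 w1 : \forall y \near x, `|'D_v1 (fun y => 'D_w1 f y) x -
    'D_v1 (fun y => 'D_w1 f y) y| < e.
  have sD := smooth_derive v1 (smooth_derive w1 sf).
  have := differentiable_continuous (smooth_differentiable sD Ux).
  by move=> /cvgrPdist_lt /(_ _ e0).
have : \forall y \near x, [/\ U y,
    `|a - 'D_v (fun y => 'D_w f y) y| < e & `|b - 'D_w (fun y => 'D_v f y) y| <
      e].
  have nU := open_nbhs_nbhs (conj oU Ux).
  by apply: filterS3 nU (cont v w) (cont w v) => y Uy Ha Hb; split;
    [exact: Uy|exact: Ha|exact: Hb].
move=> /nbhs_ballP[r /= r0 rP].
(* As [s n = r / 2], the parallelogram with sides [s v] and [s w] at [x] stays in the ball of radius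
   [r]; the summand 1 keeps [n] positive when [v] and [w] vanish. *)
pose n := 1 + `|v| + `|w|; have n0 : 0 < n.
  by rewrite /n -addrA ltr_wpDr // addr_ge0.
pose s := r / 2 / n; have s0 : 0 < s by rewrite !divr_gt0.
have inP p q : 0 <= p <= s -> 0 <= q <= s -> ball x r (p *: v + (q *: w + x)).
  move=> /andP[p0 ps] /andP[q0 qs].
  rewrite -ball_normE /= addrA opprD addrCA subrr addr0 normrN.
  apply: le_lt_trans (ler_normD _ _) _; rewrite !normrZ !ger0_norm //.
  apply: (@le_lt_trans _ _ (s * n)); last first.
    by rewrite /s mulfVK ?gt_eqF // ltr_pdivrMr // ltr_pMr // ltr1n.
  rewrite /n !mulrDr; apply: lerD; last exact: ler_wpM2r.
  by apply: ler_wpDl; [rewrite mulr1 ltW|exact: ler_wpM2r].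
have [p [q [ps qs E1]]] := mixed_MVT s0 (fun p q ps qs =>
  let Uy := let: And3 u _ _ := rP _ (inP _ _ ps qs) in u in
  conj (smooth_differentiable sf Uy)
       (smooth_differentiable (smooth_derive v sf) Uy)).
have inP' q' p' : 0 <= q' <= s -> 0 <= p' <= s ->
  ball x r (q' *: w + (p' *: v + x)).
  by move=> qs' ps'; rewrite addrCA; exact: inP.
have [q' [p' [qs' ps' E2]]] := mixed_MVT s0 (fun q p qs ps =>
  let Uy := let: And3 u _ _ := rP _ (inP' _ _ qs ps) in u in
  conj (smooth_differentiable sf Uy)
       (smooth_differentiable (smooth_derive w sf) Uy)).
(* Both orders expand the same second difference, so the two mixed derivatives agree, though at
   different points of the ball. *)
have /esym E : 'D_w (fun y => 'D_v f y) (p *: v + (q *: w + x)) =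
          'D_v (fun y => 'D_w f y) (q' *: w + (p' *: v + x)).
  have ss0 : s * s != 0 by rewrite mulf_neq0 // gt_eqF.
  move: E1 E2; rewrite (addrCA (s *: w) (s *: v) x).
  set X := 'D_w _ _; set Y := 'D_v _ _ => E1 E2; clearbody X Y.
  apply: (mulfI ss0); rewrite -E1 -E2; ring.
have [_ _ Hb] := rP _ (inP _ _ ps qs); have [_ Ha _] := rP _ (inP' _ _ qs' ps').
have : `|a - b| < `|a - b|; last by rewrite ltxx.
rewrite {2}[`|_|]splitr -/e; apply: le_lt_trans (ltrD Ha Hb).
rewrite E [X in _ <= _ + X]distrC; apply: le_trans (ler_normD _ _).
by rewrite addrA subrK.
Qed.

End Calculus.

(** * The real scalar product of C^(m+1) *)

Section Dot.
Context {R : realType} {m : nat}.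
Implicit Types (z w u v : realC R m) (a b : R).

Lemma dotC z w : dot z w = dot w z.
Proof. by apply: eq_bigr => j _; rewrite ![_ * (z.1 0 j)]mulrC; ring. Qed.

Lemma dotDl z w u : dot (z + w) u = dot z u + dot w u.
Proof. by rewrite -big_split; apply: eq_bigr => j _; rewrite /= !mxE; ring. Qed.

Lemma dotZl a z u : dot (a *: z) u = a * dot z u.
Proof. by rewrite /dot mulr_sumr; apply: eq_bigr => j _; rewrite /= !mxE;
  ring. Qed.

Lemma dotDr u z w : dot u (z + w) = dot u z + dot u w.
Proof. by rewrite dotC dotDl !(dotC _ u). Qed.

Lemma dotZr a u z : dot u (a *: z) = a * dot u z.
Proof. by rewrite dotC dotZl dotC. Qed.

Lemma dotNl z u : dot (- z) u = - dot z u.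
Proof. by rewrite -scaleN1r dotZl mulN1r. Qed.

Lemma dotNr u z : dot u (- z) = - dot u z.
Proof. by rewrite dotC dotNl dotC. Qed.

Lemma dot0l u : dot 0 u = 0.
Proof. by rewrite -(scale0r u) dotZl mul0r. Qed.

Lemma dot0r u : dot u 0 = 0.
Proof. by rewrite dotC dot0l. Qed.

Lemma dot_suml (I : finType) (F : I -> realC R m) u :
  dot (\sum_i F i) u = \sum_i dot (F i) u.
Proof.
apply: (big_morph (fun z => dot z u)); last exact: dot0l.
by move=> z w; exact: dotDl.
Qed.

Lemma mulID z w : mulI (z + w) = mulI z + mulI w.
Proof. by congr (_, _); rewrite /= opprD. Qed.

Lemma mulIZ a z : mulI (a *: z) = a *: mulI z.
Proof. by congr (_, _); rewrite /= scalerN. Qed.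

Lemma mulIK z : mulI (mulI z) = - z.
Proof. by []. Qed.

Lemma dot_mulIr z w : dot z (mulI w) = - dot (mulI z) w.
Proof. by rewrite /dot -sumrN; apply: eq_bigr => j _; rewrite /= !mxE;
  ring. Qed.

Lemma dot_mulII z w : dot (mulI z) (mulI w) = dot z w.
Proof. by rewrite dot_mulIr mulIK dotNl opprK. Qed.

Lemma dot_mulI_anti z w : dot (mulI z) w = - dot (mulI w) z.
Proof. by rewrite -dot_mulIr dotC. Qed.

Lemma dot_mulIxx z : dot (mulI z) z = 0.
Proof. by have := dot_mulI_anti z z; lra. Qed.

Lemma dot_ge0 z : 0 <= dot z z.
Proof. by apply: sumr_ge0 => j _; rewrite addr_ge0 // -expr2 sqr_ge0. Qed.

Lemma dot_eq0 z : (dot z z == 0) = (z == 0).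
Proof.
apply/eqP/eqP => [|->]; last exact: dot0l.
move=> /eqP; rewrite psumr_eq0; last first.
  by move=> j _; rewrite addr_ge0 // -expr2 sqr_ge0.
move=> /allP H; case: z H => z1 z2 H; congr (_, _); apply/rowP => j;
  rewrite !mxE;
  move: (H j (mem_index_enum _)) => /=; rewrite paddr_eq0 -?expr2 ?sqr_ge0 //;
  by rewrite !expf_eq0 /= => /andP[/eqP ? /eqP ?].
Qed.

Lemma dot_gt0 z : z != 0 -> 0 < dot z z.
Proof. by move=> z0; rewrite lt_neqAle dot_ge0 eq_sym dot_eq0 z0. Qed.

Lemma mulI_eq0 z : (mulI z == 0) = (z == 0).
Proof. by rewrite -dot_eq0 dot_mulII dot_eq0. Qed.

(** Real coordinates on C^(m+1), which turn [dot] into a matrix product and make rank arguments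
    available. *)
Let vec z : 'rV[R]_(m.+1 + m.+1) := row_mx z.1 z.2.

Let dot_vec z w : dot z w = (vec z *m (vec w)^T) 0 0.
Proof.
rewrite tr_row_mx mul_row_col mxE !mxE -big_split.
by apply: eq_bigr => j _; rewrite !mxE.
Qed.

(** Nonzero orthogonal vectors have an invertible diagonal Gram matrix, so 2m+2 of them span the
    whole space; [v] is then a combination of vectors orthogonal to it, hence orthogonal to
    itself. *)
Lemma orthogonal_total (I : finType) (F : I -> realC R m) v :
    #|I| = (m.+1 + m.+1)%N ->
    (forall i j, i != j -> dot (F i) (F j) = 0) -> (forall i, F i != 0) ->
    (forall i, dot (F i) v = 0) ->
  v = 0.
Proof.
move=> cI oF F0 vF.
pose A : 'M[R]_(#|I|, m.+1 + m.+1) := \matrix_i vec (F (enum_val i)).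
have AE i w : (A *m (vec w)^T) i 0 = dot (F (enum_val i)) w.
  by rewrite dot_vec !mxE; apply: eq_bigr => k _; rewrite !mxE.
pose d : 'rV[R]_#|I| := \row_i dot (F (enum_val i)) (F (enum_val i)).
have AA : A *m A^T = diag_mx d.
  apply/matrixP => i j; rewrite [RHS]mxE.
  have -> : (A *m A^T) i j = dot (F (enum_val i)) (F (enum_val j)).
    by rewrite -AE !mxE; apply: eq_bigr => k _; rewrite !mxE.
  rewrite mxE; case: eqP => [->|/eqP ij] //=.
  by rewrite mulr0n oF // (inj_eq enum_val_inj).
have rA : row_full A.
  rewrite /row_full eqn_leq rank_leq_col /= -{1}cI.
  apply: leq_trans (mxrankM_maxl A A^T); rewrite AA.
  rewrite mxrank_unit // unitmxE det_diag unitfE; apply/prodf_neq0 => i _.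
  by rewrite mxE dot_eq0.
have /submxP[c vE] : (vec v <= A)%MS by exact: submx_full.
apply/eqP; rewrite -dot_eq0 dot_vec {1}vE -mulmxA.
have -> : A *m (vec v)^T = 0 by apply/colP => i; rewrite AE vF mxE.
by rewrite mulmx0 mxE.
Qed.

(** * Orthogonal frames of the horizontal space *)

Section Frame.
Variables (n : realC R m) (e : 'I_(m + m) -> realC R m).
Hypotheses (n0 : n != 0) (e0 : forall i, e i != 0).
Hypothesis (eo : forall i j, i != j -> dot (e i) (e j) = 0).
Hypotheses (en : forall i, dot n (e i) = 0) (ein : forall i,
  dot (mulI n) (e i) = 0).

(** Together with [n] and [mulI n], the 2m frame vectors form 2m+2 orthogonal vectors, the full real
    dimension. *)
Lemma horizontal_frame_total v :
  horizontal n v -> (forall i, dot (e i) v = 0) -> v = 0.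
Proof.
move=> [vn vin] ve.
pose F (i : option (option 'I_(m + m))) :=
  match i with None => n | Some None => mulI n | Some (Some i) => e i end.
apply: (@orthogonal_total _ F).
- by rewrite !card_option card_ord; lia.
- move=> [[i|]|] [[j|]|] //= ij; rewrite ?eqxx // in ij; first [exact: eo |
    by rewrite ?dot_mulIxx // ?(dotC (e _)) ?en ?ein ?(dotC n) ?dot_mulIxx].
- by move=> [[i|]|] /=; rewrite ?mulI_eq0; [exact: e0|exact: n0|exact: n0].
- by move=> [[i|]|] /=; [exact: ve|exact: vin|exact: vn].
Qed.

Lemma horizontal_expansion v : horizontal n v ->
  v = \sum_i (dot (e i) v / dot (e i) (e i)) *: e i.
Proof.
move=> hv; apply/eqP; rewrite -subr_eq0; apply/eqP.
have dS z : dot z (\sum_i (dot (e i) v / dot (e i) (e i)) *: e i) =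
    \sum_i dot (e i) v / dot (e i) (e i) * dot z (e i).
  by rewrite (dotC z) dot_suml; apply: eq_bigr => i _; rewrite dotZl (dotC z).
apply: horizontal_frame_total => [|j].
  have [h1 h2] := hv.
  by split; rewrite dotDr dotNr dS big1 ?h1 ?h2 ?subr0 // => i _;
    rewrite (en, ein) mulr0.
rewrite dotDr dotNr dS (bigD1 j) //= big1 ?addr0 => [|i ij].
  by rewrite divfK ?subrr // dot_eq0.
by rewrite (@eo j i) ?mulr0 // eq_sym.
Qed.

Lemma dot_expansion v w : horizontal n v ->
  dot v w = \sum_i dot (e i) v * dot (e i) w / dot (e i) (e i).
Proof.
move=> hv; rewrite {1}(horizontal_expansion hv) dot_suml.
by apply: eq_bigr => i _; rewrite dotZl mulrAC.
Qed.

End Frame.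
End Dot.

(** * The product rule for the scalar product *)

Section DotAnalysis.
Context {R : realType} {m : nat}.
Implicit Types (z w : realC R m).

Let re_coord (j : 'I_m.+1) z : R := z.1 0 j.
Let im_coord (j : 'I_m.+1) z : R := z.2 0 j.

Let re_coord_linear j : linear (re_coord j).
Proof. by move=> a z w; rewrite /re_coord !mxE. Qed.

Let im_coord_linear j : linear (im_coord j).
Proof. by move=> a z w; rewrite /im_coord !mxE. Qed.

HB.instance Definition _ j := GRing.isLinear.Build _ _ _ _ (re_coord j)
  (re_coord_linear j).
HB.instance Definition _ j := GRing.isLinear.Build _ _ _ _ (im_coord j)
  (im_coord_linear j).

Let re_coord_continuous j : continuous (re_coord j).
Proof.
move=> z; apply: (@continuous_comp _ _ _ fst (fun u : 'rV[R]_m.+1 => u 0 j)).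
  exact: cvg_fst.
exact: coord_continuous.
Qed.

Let im_coord_continuous j : continuous (im_coord j).
Proof.
move=> z; apply: (@continuous_comp _ _ _ snd (fun u : 'rV[R]_m.+1 => u 0 j)).
  exact: cvg_snd.
exact: coord_continuous.
Qed.

Let mulI_linear : linear (@mulI R m).
Proof. by move=> a z w; rewrite mulID mulIZ. Qed.

HB.instance Definition _ :=
  GRing.isLinear.Build _ _ _ _ (@mulI R m) mulI_linear.

Lemma mulI_continuous : continuous (@mulI R m).
Proof.
move=> z.
have h1 : (fun w : realC R m => - w.2) @ z --> - z.2 by apply: cvgN;
  exact: cvg_snd.
have h2 : (fun w : realC R m => w.1) @ z --> z.1 by exact: cvg_fst.
exact: (cvg_pair h1 h2).
Qed.

(** [dot] is a finite sum of products of continuous linear coordinates, each covered by the product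
    rule for real functions. *)
Lemma leibniz_dot (V : normedModType R) : leibniz (V := V) (@dot R m).
Proof.
have l1 j : leibniz (V := V) (fun z w => re_coord j z * re_coord j w).
  exact: (leibniz_linear (L1 := re_coord j) (L2 := re_coord j)
    (@re_coord_continuous j) (@re_coord_continuous j) leibniz_mul).
have l2 j : leibniz (V := V) (fun z w => im_coord j z * im_coord j w).
  exact: (leibniz_linear (L1 := im_coord j) (L2 := im_coord j)
    (@im_coord_continuous j) (@im_coord_continuous j) leibniz_mul).
pose B (jb : 'I_m.+1 * bool) z w : R :=
  if jb.2 then re_coord jb.1 z * re_coord jb.1 w
  else im_coord jb.1 z * im_coord jb.1 w.
have lB jb : leibniz (V := V) (B jb) by case: jb => j []; [exact: l1|exact: l2].
have -> : @dot R m = fun z w => \sum_jb B jb z w.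
  apply/funext => z; apply/funext => w.
  rewrite -(pair_bigA _ (fun j b => B (j, b) z w)) /=.
  by apply: eq_bigr => j _; rewrite big_bool.
exact: leibniz_sum.
Qed.

End DotAnalysis.

(** * The graph of the nonzero components of a skew form *)

Lemma exists_notin (I : finType) (s : seq I) :
  (size s < #|I|)%N -> exists p, p \notin s.
Proof.
move=> ss; have [p _ ps] : exists2 p, p \in predT & p \notin s.
  apply/subsetPn; apply/negP => /subset_leq_card H.
  have cI : #|I| = #|predT : pred I| by exact: eq_card.
  by move: H; rewrite -cI leqNgt (leq_ltn_trans (card_size s)).
by exists p.
Qed.

Section Combinatorics.
Context {R : realFieldType} {I : finType} (om : I -> I -> R).
Hypothesis omC : forall i j, om i j = - om j i.
Hypothesis rel1 : forall i j k l, uniq [:: i; j; k; l] ->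
  om i j * om k l = - (om i k * om j l).
Hypothesis nondeg : forall i, exists j, om i j != 0.
Hypothesis nstar : forall i, exists j k, [/\ j != i, k != i & om j k != 0].
Hypothesis I5 : (5 <= #|I|)%N.

Let edge i j := om i j != 0.

Let edgeC i j : edge i j = edge j i.
Proof. by rewrite /edge omC oppr_eq0. Qed.

Let edgexx i : edge i i = false.
Proof. by apply/negbTE/negPn/eqP; have := omC i i; lra. Qed.

Let edge_neq i j : edge i j -> i != j.
Proof. by apply: contraTneq => ->; rewrite edgexx. Qed.

Let fresh (s : seq I) : (size s < 5)%N -> exists p, p \notin s.
Proof. by move=> s5; apply/exists_notin/(leq_trans s5). Qed.

(** The relation moves a nonzero product from the pairs [xy], [zt] to the pairs [xz], [yt]. *)
Let quad x y z t : uniq [:: x; y; z; t] -> edge x y -> edge z t -> edge x z.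
Proof.
move=> un xy zt; have := mulf_neq0 xy zt.
by rewrite (rel1 un) oppr_eq0 mulf_eq0 negb_or => /andP[].
Qed.

Let uniq4 (x y z t : I) : x != y -> x != z -> x != t -> y != z -> y != t ->
  z != t -> uniq [:: x; y; z; t].
Proof. by move=> *; rewrite /= !inE !negb_or; do !(apply/andP; split). Qed.

(** Start from an edge [ab]. By [nstar] some edge avoids [a] and some edge avoids [b]; unless two
    disjoint edges appear at once, these are [bd] and [ad], closing a triangle. A vertex [p] off the
    triangle has a neighbour [r], and the edge [pr] is disjoint from at least one side of the
    triangle. *)
Let disjoint_edges :
  exists a b c d, [/\ uniq [:: a; b; c; d], edge a b & edge c d].
Proof.
have [a _] := @fresh [::] isT; have [b ab] := nondeg a.
have nab := edge_neq ab; rewrite -/(edge a b) in ab.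
have [c [d [ca da cd]]] := nstar a; rewrite -/(edge c d) in cd.
have ncd := edge_neq cd.
have [bc|bc] := boolP (b \in [:: c; d]); last first.
  exists a, b, c, d; split=> //; move: bc; rewrite !inE negb_or => /andP[bc bd].
  by apply: uniq4; rewrite // eq_sym.
have {c d ca da cd ncd bc} [d [da bd]] : exists d, d != a /\ edge b d.
  move: bc; rewrite !inE => /orP[] /eqP bE; first by exists d; rewrite bE.
  by exists c; rewrite bE edgeC.
have nbd := edge_neq bd.
have [e [f [eb fb ef]]] := nstar b; rewrite -/(edge e f) in ef.
have nef := edge_neq ef.
have [ae|ae] := boolP (a \in [:: e; f]); last first.
  exists a, b, e, f; split=> //; move: ae; rewrite !inE negb_or => /andP[ae af].
  by apply: uniq4; rewrite // eq_sym.
have {e f eb fb ef nef ae} [f [fb af]] : exists f, f != b /\ edge a f.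
  move: ae; rewrite !inE => /orP[] /eqP aE; first by exists f; rewrite aE.
  by exists e; rewrite aE edgeC.
have naf := edge_neq af.
have [fd|fd] := eqVneq f d; last first.
  exists a, f, b, d; split=> //; apply: uniq4 => //; by rewrite eq_sym.
rewrite {f}fd in fb af naf.
have [p] := @fresh [:: a; b; d] isT; rewrite !inE !negb_or => /and3P[pa pb pd].
have [r pr] := nondeg p; rewrite -/(edge p r) in pr; have npr := edge_neq pr.
have [ra|ra] := eqVneq r a.
  by rewrite ra in pr; exists p, a, b, d; split=> //; apply: uniq4.
have [rb|rb] := eqVneq r b.
  rewrite rb in pr; exists p, b, a, d; split=> //; apply: uniq4 => //.
  by rewrite eq_sym.
by exists p, r, a, b; split=> //; apply: uniq4.
Qed.

Lemma totally_antisymmetric_degenerate : False.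
Proof.
have [a [b [c [d [un ab cd]]]]] := disjoint_edges.
have [p ps] := @fresh [:: a; b; c; d] isT.
have [r pr] := nondeg p; rewrite -/(edge p r) in pr; have npr := edge_neq pr.
move: un; rewrite /= !inE !negb_or.
move=> /and4P[/and3P[nab nac nad] /andP[nbc nbd] ncd _].
move: ps; rewrite !inE !negb_or => /and4P[pa pb pc pd].
have nba := nab; rewrite eq_sym in nba; have nca := nac; rewrite eq_sym in nca.
have nda := nad; rewrite eq_sym in nda; have ncb := nbc; rewrite eq_sym in ncb.
have ndb := nbd; rewrite eq_sym in ndb; have ndc := ncd; rewrite eq_sym in ndc.
have ba : edge b a by rewrite edgeC.
have dc : edge d c by rewrite edgeC.
have ac : edge a c by apply: (@quad a b c d) => //; exact: uniq4.
have ad : edge a d by apply: (@quad a b d c) => //; exact: uniq4.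
have bc : edge b c by apply: (@quad b a c d) => //; exact: uniq4.
have bd : edge b d by apply: (@quad b a d c) => //; exact: uniq4.
(* The edge [pr] is used against an edge [xy] with [r != y]: either [r] is [x], or the two edges are
   disjoint and [quad] applies. *)
have adj x y : p != x -> p != y -> x != y -> r != y -> edge x y -> edge p x.
  move=> px py xy ry xyE; have [rx|rx] := eqVneq r x; first by rewrite -rx.
  by apply: (@quad p r x y) => //; apply: uniq4.
(* A vertex [x] with two neighbours always has one that differs from [r], so [adj] applies to it. *)
have P x y z : p != x -> p != y -> p != z -> x != y -> x != z -> y != z ->
    edge x y -> edge x z -> edge p x.
  move=> px py pz xy xz yz xyE xzE.
  have [ry|ry] := eqVneq r y; last exact: (adj x y).
  by apply: (adj x z) => //; rewrite ry.
have Pa : edge p a by apply: (P a b c).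
have Pb : edge p b by apply: (P b a c).
have Pc : edge p c by apply: (P c a b) => //; rewrite edgeC.
have Pd : edge p d by apply: (P d a b) => //; rewrite edgeC.
have e1 := rel1 (uniq4 pc pa pb nca ncb nab).
have e2 := rel1 (uniq4 pd pc pb ndc ndb ncb).
have e3 := rel1 (uniq4 pa pd pb nad nab ndb).
(* The identity [E] combines the three relations linearly, which avoids divisions, and shows that
   twice this product is zero, although all four factors are edges. *)
have H : om p c * om p d * om p a * om a b = 0.
  move: e1 e2 e3; set x := om p a; set y := om p c; set z := om p d.
  move=> e1 e2 e3.
  have E : y * z * x * om a b + y * z * x * om a b =
      (y * om a b + x * om c b) * (z * x) - x * x * (z * om c b + y * om d b)
      + x * y * (x * om d b + z * om a b) by ring.
  by rewrite e1 e2 e3 !addNr mulr0 mul0r mulr0 subr0 addr0 in E; lra.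
move: H => /eqP; rewrite !mulf_eq0; move: Pa Pc Pd ab; rewrite /edge.
by do 4 move=> /negbTE ->.
Qed.

End Combinatorics.

(** * Lifts of orthogonal coordinates *)

(** Locked, so that unification does not unfold iterated partial derivatives. *)
HB.lock Definition partial {R : realType} {n : nat} {W : normedModType R}
  (i : 'I_n) (f : 'rV[R]_n -> W) (x : 'rV[R]_n) : W := 'D_(delta_mx 0 i) f x.

Lemma partialE (R : realType) (n : nat) (W : normedModType R) (i : 'I_n)
  (f : 'rV[R]_n -> W) x : partial i f x = 'D_(delta_mx 0 i) f x.
Proof. by rewrite partial.unlock. Qed.

Section OrthogonalLift.
Context {R : realType} {m : nat}.

(* For u, v tangent at z <> 0, [gram z u v / dot z z] is the product of the
   components of u and v orthogonal to the complex line spanned by z. *)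
Definition gram (z u v : realC R m) : R :=
  dot z z * dot u v - (dot z u * dot z v + dot (mulI z) u * dot (mulI z) v).

(** * The Kähler form in an orthogonal horizontal frame *)

Section Frame.
Variables (n : realC R m) (e : 'I_(m + m) -> realC R m).
Hypotheses (n0 : n != 0) (e0 : forall i, e i != 0).
Hypothesis (eo : forall i j, i != j -> dot (e i) (e j) = 0).
Hypothesis eh : forall i, horizontal n (e i).
Hypothesis m2 : (1 < m)%N.

(** The components of the Kähler form in the frame. *)
Let om i j := dot (mulI (e i)) (e j).

Let en i : dot n (e i) = 0. Proof. by have [] := eh i. Qed.
Let ein i : dot (mulI n) (e i) = 0. Proof. by have [] := eh i. Qed.

Lemma horizontal_mulI (z u : realC R m) : horizontal z u ->
  horizontal z (mulI u).
Proof. by move=> [zu izu]; split;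
  rewrite ?dot_mulII // dot_mulIr izu oppr0. Qed.

(** Otherwise [mulI (e i)], which is horizontal, would be orthogonal to the whole frame. *)
Lemma kahler_nondegenerate i : exists j, om i j != 0.
Proof.
apply: contrapT => /forallNP H; have /eqP := e0 i; apply.
apply/eqP; rewrite -mulI_eq0; apply/eqP.
apply: (horizontal_frame_total n0 e0 eo en ein); first exact: horizontal_mulI.
by move=> j; rewrite dotC; apply/eqP/negP => /negP; exact: H.
Qed.

(** If every edge contained [i], then for two further indices [j] and [k] both [mulI (e j)] and
    [mulI (e k)] would be multiples of [e i]. Being orthogonal, they cannot both be nonzero. *)
Lemma kahler_not_star i : exists j k, [/\ j != i, k != i & om j k != 0].
Proof.
apply: contrapT => H.
have Z j k : j != i -> k != i -> om j k = 0.
  by move=> ji ki; apply/eqP/negP => /negP jk; apply: H; exists j, k.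
have [|j] := @exists_notin _ [:: i]; first by rewrite card_ord /=; lia.
rewrite inE => ji.
have [|k] := @exists_notin _ [:: i; j]; first by rewrite card_ord /=; lia.
rewrite !inE negb_or => /andP[ki kj].
have := dot_expansion n0 e0 eo en ein (mulI (e k)) (horizontal_mulI (eh j)).
rewrite dot_mulII eo 1?eq_sym // (bigD1 i) //= big1 ?addr0 => [/esym/eqP|l li].
  2: by rewrite dotC [dot (mulI _) _](Z j l) // !mul0r.
rewrite !mulf_eq0 invr_eq0 dot_eq0 (negbTE (e0 i)) orbF.
have T l : l != i -> dot (e i) (mulI (e l)) = 0 -> False.
  move=> li il; have /eqP := e0 l; apply.
  apply/eqP; rewrite -mulI_eq0; apply/eqP.
  apply: (horizontal_frame_total n0 e0 eo en ein); first exact: horizontal_mulI.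
  move=> p; have [->//|pi] := eqVneq p i.
  by rewrite dotC; exact: Z.
by move=> /orP[] /eqP; exact: T.
Qed.

(** Parseval's formula has no surviving term when the two vectors have components in disjoint sets
    of indices. *)
Lemma dot_disjoint_components (v w : realC R m) (I J : pred 'I_(m + m)) :
    horizontal n v -> (forall l, ~~ I l -> dot v (e l) = 0) ->
    (forall l, ~~ J l -> dot w (e l) = 0) -> (forall l, I l -> ~~ J l) ->
  dot v w = 0.
Proof.
move=> hv vI wJ IJ; rewrite (dot_expansion n0 e0 eo en ein w hv).
apply: big1 => l _; have [Il|/negP Il] := boolP (I l).
  by rewrite (dotC _ w) wJ ?IJ // mulr0 mul0r.
by rewrite (dotC _ v) vI ?mul0r //; exact/negP.
Qed.

End Frame.

(** * The orthogonality relation differentiated up to order 2 *)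

Section Lift.
Local Notation V := 'rV[R]_(m + m).
Variables (U : set V) (q : V) (E : V -> realC R m).
Hypotheses (oU : open U) (Uq : U q) (sE : smooth_on U E).
Hypothesis m3 : (3 <= m)%N.

Local Notation D := partial.

Hypothesis G0 : forall x i j, U x -> i != j ->
  gram (E x) (D i E x) (D j E x) = 0.
Hypothesis EN : forall x, U x -> dot (E q) (E x) = dot (E q) (E q).
Hypothesis EI : forall x, U x -> dot (mulI (E q)) (E x) = 0.
Hypothesis E0 : E q != 0.
Hypothesis DE0 : forall i, D i E q != 0.

Let sD (W : normedModType R) i (f : V -> W) : smooth_on U f ->
  smooth_on U (D i f).
Proof.
move=> sf; have s := smooth_derive (delta_mx 0 i) sf.
by apply: smooth_ext s => // x _; rewrite partialE.
Qed.

Let D_eq (W : normedModType R) i (f g : V -> W) x :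
  (forall y, U y -> f y = g y) -> U x -> D i f x = D i g x.
Proof. by move=> fg Ux; rewrite !partialE;
  exact: (derive_eq_on oU _ fg Ux). Qed.

Let D_cst (W : normedModType R) (i : 'I_(m + m)) (a : W) (x : V) : D i (fun=>
  a) x = 0.
Proof. by rewrite partialE derive_cst. Qed.

Let sdot (f g : V -> realC R m) : smooth_on U f -> smooth_on U g ->
  smooth_on U (fun x => dot (f x) (g x)).
Proof. by move=> sf sg; exact: (smooth_leibniz oU (leibniz_dot V) sf sg). Qed.

Let Ddot (f g : V -> realC R m) i x : smooth_on U f -> smooth_on U g -> U x ->
  D i (fun x => dot (f x) (g x)) x = dot (D i f x) (g x) + dot (f x) (D i g x).
Proof.
move=> sf sg Ux; rewrite !partialE.
exact: (derive_leibniz _ (leibniz_dot V) sf sg Ux).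
Qed.

Let DM (f g : V -> R) i x : smooth_on U f -> smooth_on U g -> U x ->
  D i (fun x => f x * g x) x = D i f x * g x + f x * D i g x.
Proof.
move=> sf sg Ux; rewrite !partialE.
exact: (derive_leibniz _ leibniz_mul sf sg Ux).
Qed.

Let DD (f g : V -> R) i x : smooth_on U f -> smooth_on U g -> U x ->
  D i (fun x => f x + g x) x = D i f x + D i g x.
Proof. by move=> sf sg Ux; rewrite !partialE; exact: smooth_deriveD. Qed.

Let smulI (f : V -> realC R m) : smooth_on U f ->
  smooth_on U (fun x => mulI (f x)).
Proof. by move=> sf; exact: (smooth_linear (L :=
  @mulI R m) oU (@mulI_continuous R m) sf). Qed.

Let DmulI (f : V -> realC R m) i x : smooth_on U f -> U x ->
  D i (fun x => mulI (f x)) x = mulI (D i f x).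
Proof.
move=> sf Ux; rewrite !partialE.
have [_ H] := derive_linear (@mulI_continuous R m) (smooth_differentiable sf
  Ux).
exact: H.
Qed.

Let Ddotr (f : V -> realC R m) i c x : smooth_on U f -> U x ->
  D i (fun y => dot c (f y)) x = dot c (D i f x).
Proof. by move=> sf Ux;
  rewrite (Ddot i (smooth_cst oU c) sf Ux) D_cst dot0l add0r. Qed.

Let Ddot_cst (f : V -> realC R m) i c a x : smooth_on U f ->
  (forall x, U x -> dot c (f x) = a) -> U x -> dot c (D i f x) = 0.
Proof. by move=> sf fa Ux; rewrite -(Ddotr i c sf Ux) (D_eq i fa Ux) D_cst. Qed.

Let Dsym (f : V -> realC R m) i j x : smooth_on U f -> U x ->
  D i (D j f) x = D j (D i f) x.
Proof.
move=> sf Ux.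
(* Pairing with a constant [c] reduces to real functions; taking the difference itself for [c] then
   shows that it vanishes. *)
suff Q c : dot c (D i (D j f) x - D j (D i f) x) = 0.
  by apply/eqP; rewrite -subr_eq0 -dot_eq0 Q.
have K k l : D k (D l (fun y => dot c (f y))) x = dot c (D k (D l f) x).
  rewrite -(Ddotr k c (sD l sf) Ux); apply: D_eq => // y Uy; exact: Ddotr.
have sc : smooth_on U (fun y => dot c (f y))
  by exact: sdot (smooth_cst oU c) sf.
rewrite dotDr dotNr -!K; apply/eqP; rewrite subr_eq0; apply/eqP.
have F k : D k (fun y => dot c (f y)) = fun y => 'D_(delta_mx 0 k) (fun y =>
  dot c (f y)) y.
  by apply/funext => y; rewrite partialE.
rewrite !F !partialE; exact: (derive_symmetric _ _ oU sc Ux).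
Qed.

Let n := E q.
Let e i := D i E q.
Let e2 i j := D i (D j E) q.
Let e3 i j k := D i (D j (D k E)) q.
Let om i j := dot (mulI (e i)) (e j).

(** As the Hermitian product of [E] with [n] is constant, the partial derivatives of [E] of orders 1
    and 2 are horizontal at [n], and this on all of [U]. *)
Let DEn i x : U x -> dot n (D i E x) = 0.
Proof. exact: Ddot_cst EN. Qed.
Let DEin i x : U x -> dot (mulI n) (D i E x) = 0.
Proof. exact: Ddot_cst EI. Qed.
Let DDEn i j x : U x -> dot n (D i (D j E) x) = 0.
Proof. by apply: Ddot_cst (sD _ sE) _ => y; exact: DEn. Qed.
Let DDEin i j x : U x -> dot (mulI n) (D i (D j E) x) = 0.
Proof. by apply: Ddot_cst (sD _ sE) _ => y; exact: DEin. Qed.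

(** In these terms the vanishing of [gram] reads [N * P i j = X i * X j + Y i * Y j]. Since [X] and
    [Y] vanish at [q], most terms of its derivatives disappear there. *)
Let X i x := dot (E x) (D i E x).
Let Y i x := dot (mulI (E x)) (D i E x).
Let N x := dot (E x) (E x).
Let P i j x := dot (D i E x) (D j E x).

Let sX i : smooth_on U (X i). Proof. exact: sdot sE (sD _ sE). Qed.
Let sY i : smooth_on U (Y i). Proof. exact: sdot (smulI sE) (sD _ sE). Qed.
Let sN : smooth_on U N. Proof. exact: sdot. Qed.
Let sP i j : smooth_on U (P i j). Proof. exact: sdot (sD _ sE) (sD _ sE). Qed.

Let Xq i : X i q = 0. Proof. exact: DEn. Qed.
Let Yq i : Y i q = 0. Proof. exact: DEin. Qed.

Let DXq k i : D k (X i) q = dot (e k) (e i).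
Proof. by rewrite /X Ddot ?DDEn ?addr0 //; exact: sD. Qed.

Let DYq k i : D k (Y i) q = om k i.
Proof. by rewrite /Y Ddot ?DDEin ?addr0 ?DmulI //;
  [exact: smulI|exact: sD]. Qed.

Let DN k x : U x -> D k N x = X k x + X k x.
Proof. by move=> Ux; rewrite /N Ddot // [dot (D k E x) _]dotC. Qed.

Let DNq k : D k N q = 0. Proof. by rewrite DN // Xq addr0. Qed.

(** Order 0: at [q] the right-hand side vanishes and [N] does not. *)
Let eo i j : i != j -> dot (e i) (e j) = 0.
Proof.
move=> ij; have := G0 Uq ij;
  rewrite /gram -/(X i q) -/(X j q) -/(Y i q) -/(Y j q).
rewrite !(Xq, Yq) mul0r addr0 subr0 => /eqP; rewrite mulf_eq0 dot_eq0.
by rewrite (negbTE E0) => /eqP.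
Qed.

Let NPE i j x : i != j -> U x ->
  N x * P i j x = X i x * X j x + Y i x * Y j x.
Proof. by move=> ij Ux; apply/eqP; rewrite -subr_eq0; apply/eqP; exact: G0. Qed.

Let DP k i j x : U x ->
  D k (P i j) x = dot (D k (D i E) x) (D j E x) + dot (D i E x) (D k (D j E) x).
Proof. by move=> Ux; rewrite /P Ddot //; exact: sD. Qed.

Let Q i j x := X i x * X j x + Y i x * Y j x.

Let DQ k i j x : U x -> D k (Q i j) x =
  (D k (X i) x * X j x + X i x * D k (X j) x) +
  (D k (Y i) x * Y j x + Y i x * D k (Y j) x).
Proof.
move=> Ux; rewrite (DD k (smooth_mul oU (sX i) (sX j)) (smooth_mul oU (sY i)
  (sY j)) Ux).
by rewrite (DM k (sX i) (sX j) Ux) (DM k (sY i) (sY j) Ux).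
Qed.

Let DNP k i j x : U x ->
  D k (fun x => N x * P i j x) x = D k N x * P i j x + N x * D k (P i j) x.
Proof. by move=> Ux; rewrite (DM k sN (sP i j) Ux). Qed.

Let D2M (f g : V -> R) k l x : smooth_on U f -> smooth_on U g -> U x ->
  D k (fun y => D l f y * g y + f y * D l g y) x =
  D k (D l f) x * g x + D l f x * D k g x + (D k f x * D l g x + f x * D k (D l
    g) x).
Proof.
move=> sf sg Ux; rewrite (DD k (smooth_mul oU (sD l sf) sg) (smooth_mul oU sf
  (sD l sg)) Ux).
by rewrite (DM k (sD l sf) sg Ux) (DM k sf (sD l sg) Ux).
Qed.

(** Order 1: at [q] the derivative of [N] is zero, and each product on the right keeps an
    undifferentiated factor [X] or [Y], which is zero. *)
Let e2_skew k i j : i != j -> dot (e2 k i) (e j) + dot (e2 k j) (e i) = 0.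
Proof.
move=> ij; have := D_eq k (fun x Ux => NPE ij Ux) Uq.
rewrite (DNP k i j Uq) -/(Q i j) (DQ k i j Uq) DNq (DP k i j Uq) !Xq !Yq.
rewrite !(mulr0, mul0r, addr0, add0r) => /eqP; rewrite mulf_eq0 dot_eq0.
by rewrite (negbTE E0) [dot (D i E q) _]dotC => /eqP.
Qed.

(** A quantity with three indices that is symmetric in the first two (Schwarz) and skew in the last
    two ([e2_skew]) vanishes. *)
Let e2_orth i j k : i != j -> i != k -> j != k -> dot (e2 i j) (e k) = 0.
Proof.
have sym a b : e2 a b = e2 b a by exact: Dsym.
move=> ij ik jk; have ji := ij; have ki := ik; have kj := jk.
rewrite eq_sym in ji; rewrite eq_sym in ki; rewrite eq_sym in kj.
have := e2_skew i jk; have := e2_skew k ij; have := e2_skew j ki.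
rewrite (sym k i) (sym j i) (sym k j); lra.
Qed.

(** Order 2, along [l] and then [k]. On the right only products of first derivatives survive at [q];
    those of [X] are scalar products of distinct frame vectors, so zero, and those of [Y] are
    components of [om]. *)
Let second_order i j k l : uniq [:: i; j; k; l] ->
  N q * (dot (e3 k l i) (e j) + dot (e3 k l j) (e i)) =
  om l i * om k j + om k i * om l j.
Proof.
rewrite /= !inE !negb_or => /and4P[/and3P[ij ik il] /andP[jk jl] kl _].
have ji := ij; rewrite eq_sym in ji; have ki := ik; rewrite eq_sym in ki.
have li := il; rewrite eq_sym in li; have kj := jk; rewrite eq_sym in kj.
have lj := jl; rewrite eq_sym in lj; have lk := kl; rewrite eq_sym in lk.
have L2 x : U x -> D l N x * P i j x + N x * D l (P i j) x =
    (D l (X i) x * X j x + X i x * D l (X j) x) +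
    (D l (Y i) x * Y j x + Y i x * D l (Y j) x).
  move=> Ux; rewrite -(DNP l i j Ux) -(DQ l i j Ux).
  by apply: D_eq => // y Uy; exact: NPE.
have := D_eq k L2 Uq.
rewrite (D2M k l sN (sP i j) Uq).
rewrite (DD k _ _ Uq); first last.
- exact: smoothD (smooth_mul oU (sD l (sY i)) (sY j)) (smooth_mul oU (sY i) (sD
  l (sY j))).
- exact: smoothD (smooth_mul oU (sD l (sX i)) (sX j)) (smooth_mul oU (sX i) (sD
  l (sX j))).
rewrite (D2M k l (sX i) (sX j) Uq) (D2M k l (sY i) (sY j) Uq).
rewrite !Xq !Yq !DXq !DYq !DNq.
have -> : D k (D l N) q = 0.
  by rewrite (D_eq k (fun x Ux => DN l Ux) Uq) (DD k (sX l) (sX l) Uq) DXq (eo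
    kl) addr0.
have DDP : D k (D l (P i j)) q = dot (e3 k l i) (e j) + dot (e3 k l j) (e i).
  rewrite (D_eq k (fun x Ux => DP l i j Ux) Uq).
  rewrite (DD k (sdot (sD l (sD i sE)) (sD j sE)) (sdot (sD i sE) (sD l (sD j
    sE))) Uq).
  rewrite (Ddot k (sD l (sD i sE)) (sD j sE) Uq) (Ddot k (sD i sE) (sD l (sD j
    sE)) Uq).
  (* By [e2_orth] each second derivative is a combination of the two frame vectors with its own
     indices, so disjoint pairs of indices give orthogonal vectors. *)
  have D2 a b c d : uniq [:: a; b; c; d] -> dot (e2 a b) (e2 c d) = 0.
    rewrite /= !inE !negb_or => /and4P[/and3P[ab ac ad] /andP[bc bd] cd _].
    have eh p : horizontal n (e p) by split; [exact: DEn|exact: DEin].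
    apply: (dot_disjoint_components E0 DE0 eo eh (I := pred2 a b) (J :=
      pred2 c d)).
    + by split; [exact: DDEn|exact: DDEin].
    + by move=> p /=; rewrite negb_or => /andP[pa pb]; apply: e2_orth;
      rewrite // eq_sym.
    + by move=> p /=; rewrite negb_or => /andP[pc pd]; apply: e2_orth;
      rewrite // eq_sym.
    + by move=> p /= /orP[] /eqP->; rewrite negb_or; apply/andP.
  rewrite -/(e2 l i) -/(e2 k j) -/(e2 k i) -/(e2 l j) !D2 /= ?inE ?negb_or
    ?(ij, ik, il, jk, jl, kl, ji, ki, li, kj, lj, lk) //.
  by rewrite addr0 add0r [dot (D i E q) _]dotC.
rewrite DDP !(mul0r, mulr0, addr0, add0r) => ->.
by rewrite (eo li) (eo ki) !mul0r !add0r.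
Qed.

(** Third derivatives are symmetric, so the product of [e3] at three of the indices with [e] at the
    fourth depends only on the fourth. [second_order] gives the sum of two such numbers for each
    pair of indices, and complementary pairs have the same right-hand side; hence the four numbers
    are equal, and so are the three right-hand sides. These add up to zero, so each of them
    vanishes. *)
Let rel1 i j k l : uniq [:: i; j; k;
  l] -> om i j * om k l = - (om i k * om j l).
Proof.
move=> un; have omC a b : om a b = - om b a by exact: dot_mulI_anti.
have S1 a b c : e3 a b c = e3 b a c by apply: Dsym => //; exact: sD.
have S2 a b c : e3 a b c = e3 a c b.
  by apply: (D_eq a _ Uq) => x Ux; exact: Dsym.
have rot a b c : e3 a b c = e3 c a b by rewrite S2 S1.
move: un; rewrite /= !inE !negb_or.
move=> /and4P[/and3P[ij ik il] /andP[jk jl] kl _].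
have ji := ij; rewrite eq_sym in ji; have ki := ik; rewrite eq_sym in ki.
have li := il; rewrite eq_sym in li; have kj := jk; rewrite eq_sym in kj.
have lj := jl; rewrite eq_sym in lj; have lk := kl; rewrite eq_sym in lk.
(* One instance for each of the six pairs of indices, complementary pairs being consecutive. *)
have F1 := @second_order i j k l; have F2 := @second_order k l i j.
have F3 := @second_order i k j l; have F4 := @second_order j l i k.
have F5 := @second_order i l j k; have F6 := @second_order j k i l.
move: F1 F2 F3 F4 F5 F6; rewrite /= !inE !negb_or.
rewrite ij ik il jk jl kl ji ki li kj lj lk /=.
move=> /(_ isT) F1 /(_ isT) F2 /(_ isT) F3 /(_ isT) F4 /(_ isT) F5 /(_ isT) F6.
move: F1 F2 F3 F4 F5 F6.
rewrite (rot k l i) (rot k l j) (rot j l i) (S2 j l k) (S2 i k j) (rot j k i).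
rewrite (S2 i l j) (S2 i l k).
rewrite (S1 i k l) (S1 k i l).
rewrite (omC l i) (omC k i) (omC k j) (omC l j) (omC l k) (omC j i).
set s1 := dot _ _; set s2 := dot _ _; move=> F1.
set s3 := dot _ _; set s4 := dot _ _; move=> F2.
move: F1 F2; set a := om i j; set b := om k l; set c := om i k; set d := om j l.
set f := om i l; set g := om j k; set h := N q.
move=> *; lra.
Qed.

Lemma no_orthogonal_lift : False.
Proof.
have eh i : horizontal n (e i) by split; [exact: DEn|exact: DEin].
have m1 : (1 < m)%N by lia.
apply: (@totally_antisymmetric_degenerate R _ om) => //.
- by move=> i j; exact: dot_mulI_anti.
- by move=> i; exact: (kahler_nondegenerate E0 DE0 eo eh).
- by move=> i; exact: (kahler_not_star E0 DE0 eo eh m1).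
(* There are 2m >= 6 indices, enough for the five vertices. *)
- by rewrite card_ord; lia.
Qed.

End Lift.
End OrthogonalLift.

(** * Points and affine charts of the projective space *)

Section Projective.
Context {R : realType} {m : nat}.
Implicit Types (z w u v : realC R m) (a b : R) (p : CP R m) (k : 'I_m.+1).

(** Multiplication by the complex number [a + ib], as a real linear map. *)
Definition cmul a b z : realC R m := a *: z + b *: mulI z.

Lemma cmulZ t a b z : t *: cmul a b z = cmul a b (t *: z).
Proof. by rewrite /cmul scalerDr mulIZ !scalerA mulrC [t * b]mulrC. Qed.

Lemma cmulD a b z w : cmul a b (z + w) = cmul a b z + cmul a b w.
Proof. by rewrite /cmul mulID !scalerDr addrACA. Qed.

Lemma mulI_cmul a b z : mulI (cmul a b z) = cmul a b (mulI z).
Proof. by rewrite /cmul mulID !mulIZ. Qed.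

Lemma dot_cmul a b z w :
  dot (cmul a b z) (cmul a b w) = (a ^+ 2 + b ^+ 2) * dot z w.
Proof.
rewrite /cmul !(dotDl, dotDr, dotZl, dotZr) !dot_mulII !dot_mulIr; ring.
Qed.

(** The factor is the fourth power of the modulus of [a + ib]; it governs the change of lift by a
    constant complex factor. *)
Lemma gram_cmul a b z u v :
  gram (cmul a b z) (cmul a b u) (cmul a b v) =
  (a ^+ 2 + b ^+ 2) ^+ 2 * gram z u v.
Proof. by rewrite /gram mulI_cmul !dot_cmul; ring. Qed.

(** [gram z] only sees components orthogonal to the complex line of [z], and [cmul a b z] has
    none. *)
Lemma gram_cmulr z a b v : gram z (cmul a b z) v = 0.
Proof.
rewrite /gram /cmul !(dotDl, dotDr, dotZl, dotZr) !dot_mulII.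
rewrite dot_mulIr dot_mulIxx; ring.
Qed.

Lemma cmul_neq0 a b z : (a ^+ 2 + b ^+ 2) * dot z z != 0 -> cmul a b z != 0.
Proof. by rewrite -dot_cmul dot_eq0. Qed.

Lemma toC_cmul a b z : toC (cmul a b z) = (a +i* b)%C *: toC z.
Proof.
apply/rowP => j; rewrite /toC !mxE; apply/eqP; rewrite eq_complex /cmul /=.
by apply/andP; split; apply/eqP; ring.
Qed.

Lemma toC_inj : injective (@toC R m).
Proof.
move=> [z1 z2] [w1 w2] /rowP zw; congr (_, _); apply/rowP => j;
  by have := zw j; rewrite /toC !mxE => -[].
Qed.

Lemma toC_surj (c : 'rV[R[i]]_m.+1) : exists z, toC z = c.
Proof.
exists (\row_j complex.Re (c 0 j), \row_j complex.Im (c 0 j)).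
by apply/rowP => j; rewrite /toC !mxE /=; case: (c 0 j).
Qed.

Lemma toC0 : toC (0 : realC R m) = 0.
Proof. by apply/rowP => j; rewrite /toC !mxE. Qed.

Lemma toC_eq0 z : (toC z == 0) = (z == 0).
Proof. by rewrite -toC0 (inj_eq toC_inj). Qed.

Lemma line_cp_proj z : z != 0 -> line (cp_proj z) = <[toC z]>%VS.
Proof. by move=> z0; rewrite /cp_proj -[line _]/(val _) insubdK // unfold_in /=
  dim_vline toC_eq0 z0. Qed.

Lemma eq_vline (K : fieldType) (vT : vectType K) (x y : vT) :
  x != 0 -> x \in <[y]>%VS -> (<[x]> = <[y]>)%VS.
Proof.
move=> x0 xy; apply/eqP; rewrite eqEdim -memvE xy /= !dim_vline x0.
by case: (y != 0).
Qed.

Lemma cp_proj_eqP z w : z != 0 -> w != 0 ->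
  cp_proj z = cp_proj w <-> exists a b, z = cmul a b w.
Proof.
move=> z0 w0; split=> [zw|[a [b zE]]].
  have : toC z \in line (cp_proj w).
    by rewrite -zw line_cp_proj // memv_line.
  rewrite line_cp_proj // => /vlineP[[a b] zE].
  by exists a, b; apply: toC_inj; rewrite toC_cmul.
apply: val_inj; rewrite /= !line_cp_proj //; apply: eq_vline.
  by rewrite toC_eq0.
by rewrite zE toC_cmul memvZ // memv_line.
Qed.

Lemma cp_proj_cmul a b z : cmul a b z != 0 -> cp_proj (cmul a b z) = cp_proj z.
Proof.
move=> abz; have z0 : z != 0.
  by apply: contraNneq abz => ->; rewrite -dot_eq0 dot_cmul dot0l mulr0.
by apply/cp_proj_eqP => //; exists a, b.
Qed.

Lemma line_vpick p : vpick (line p) != 0 /\ line p = <[vpick (line p)]>%VS.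
Proof.
have d1 : \dim (line p) = 1%N by case: p => l /= /eqP.
have v0 : vpick (line p) != 0 by rewrite vpick0 -dimv_eq0 d1.
split=> //; apply/eqP; rewrite eq_sym eqEdim -memvE memv_pick dim_vline v0 d1.
by [].
Qed.

Lemma cp_proj_surj p : exists2 z, z != 0 & cp_proj z = p.
Proof.
have [v0 pE] := line_vpick p; have [z zE] := toC_surj (vpick (line p)).
have z0 : z != 0 by rewrite -toC_eq0 zE.
by exists z => //; apply: val_inj; rewrite /= line_cp_proj // zE -pE.
Qed.

(** The default value 0 of [xget] is not reached: any representative divided by its norm
    qualifies. *)
Lemma unit_repP p : dot (unit_rep p) (unit_rep p) = 1 /\ cp_proj (unit_rep p) =
  p.
Proof.
rewrite /unit_rep; case: xgetP => [z _ []//|H]; exfalso.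
have [z z0 zp] := cp_proj_surj p.
have d0 := dot_gt0 z0; pose t := (Num.sqrt (dot z z))^-1.
apply: (H (cmul t 0 z)); have tE : (t ^+ 2 + 0 ^+ 2) * dot z z = 1.
  by rewrite expr0n addr0 exprVn sqr_sqrtr ?ltW // mulVf // gt_eqF.
split; first by rewrite dot_cmul tE.
by rewrite cp_proj_cmul // cmul_neq0 // tE oner_eq0.
Qed.

(** The vector chosen on a line is known only up to a nonzero complex factor, which cancels in the
    quotients defining the affine coordinates. *)
Lemma vpick_cp_proj z : z != 0 ->
  exists2 c : R[i], c != 0 & vpick (line (cp_proj z)) = c *: toC z.
Proof.
move=> z0; have [v0 _] := line_vpick (cp_proj z).
have := memv_pick (line (cp_proj z));
  rewrite {2}line_cp_proj // => /vlineP[c cE].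
by exists c => //; apply: contraNneq v0 => c0; rewrite cE c0 scale0r.
Qed.

Lemma affine_domE k z : z != 0 ->
  chart_dom (affine_chart R k) (cp_proj z) <-> toC z 0 k != 0.
Proof.
move=> z0; have [c c0 cE] := vpick_cp_proj z0.
by rewrite /= cE mxE mulf_eq0 negb_or c0.
Qed.

Lemma affine_coordE k z : z != 0 ->
  chart_coord (affine_chart R k) (cp_proj z) =
  row_mx (\row_j complex.Re (toC z 0 (lift k j) / toC z 0 k))
         (\row_j complex.Im (toC z 0 (lift k j) / toC z 0 k)).
Proof.
move=> z0; have [c c0 cE] := vpick_cp_proj z0; rewrite /= cE.
have E j : (c *: toC z) 0 (lift k j) / (c *: toC z) 0 k =
    toC z 0 (lift k j) / toC z 0 k.
  by rewrite !(mxE _ _ 0 _) -mulf_div divff // mul1r.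
by congr row_mx; apply/rowP => j; rewrite !(mxE _ _ 0 j) E.
Qed.

(** The representative whose homogeneous coordinate of index [k] is 1. *)
Definition affine_lift k (x : 'rV[R]_(m + m)) : realC R m :=
  (\row_i (if unlift k i is Some j then lsubmx x 0 j else 1),
   \row_i (if unlift k i is Some j then rsubmx x 0 j else 0)).

Lemma toC_affine_lift k x : toC (affine_lift k x) 0 k = 1.
Proof. by rewrite /toC !mxE unlift_none. Qed.

Lemma affine_lift_neq0 k x : affine_lift k x != 0.
Proof.
rewrite -toC_eq0; apply/eqP => /rowP /(_ k); rewrite toC_affine_lift mxE.
by move/eqP; rewrite oner_eq0.
Qed.

Lemma affine_paramK k p : chart_dom (affine_chart R k) p ->
  cp_proj (affine_lift k (chart_coord (affine_chart R k) p)) = p.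
Proof.
have [z z0 <-{p}] := cp_proj_surj p; move=> /affine_domE => /(_ z0) zk.
rewrite affine_coordE //;
  have [a [b ab]] : exists a b, (toC z 0 k)^-1 = (a +i* b)%C.
  by case: (_^-1) => a b; exists a, b.
(* The lift of the coordinates of the line of [z] is [z] divided by its coordinate of index [k]. *)
set w := affine_lift _ _; suff wE : w = cmul a b z.
  by rewrite wE cp_proj_cmul // -wE affine_lift_neq0.
apply: toC_inj; rewrite toC_cmul -ab; apply/rowP => i.
rewrite [RHS]mxE mulrC; case: (unliftP k i) => [j|] ->; last first.
  by rewrite toC_affine_lift divff.
rewrite [LHS]mxE /w /affine_lift /= !(mxE _ _ 0 (lift k j)) liftK.
rewrite row_mxKl row_mxKr !mxE.
by case: (_ / _).
Qed.

(** * Differentiability of the affine coordinates *)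

Lemma toC_neq0P z k : (toC z 0 k != 0) = (0 < z.1 0 k ^+ 2 + z.2 0 k ^+ 2).
Proof.
rewrite lt0r addr_ge0 ?sqr_ge0 // andbT paddr_eq0 ?sqr_ge0 //.
by rewrite !expf_eq0 /= /toC mxE eq_complex.
Qed.

Let nsq k z : R := z.1 0 k ^+ 2 + z.2 0 k ^+ 2.

Let differentiable_re k z : differentiable (fun w : realC R m => w.1 0 k) z.
Proof.
have d1 : differentiable (fst : realC R m -> 'rV[R]_m.+1) z.
  by apply: linear_differentiable => w; exact: cvg_fst.
exact: (differentiable_comp d1 (differentiable_coord _ 0 k)).
Qed.

Let differentiable_im k z : differentiable (fun w : realC R m => w.2 0 k) z.
Proof.
have d1 : differentiable (snd : realC R m -> 'rV[R]_m.+1) z.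
  by apply: linear_differentiable => w; exact: cvg_snd.
exact: (differentiable_comp d1 (differentiable_coord _ 0 k)).
Qed.

Let differentiable_nsq k z : differentiable (nsq k) z.
Proof.
apply: differentiableD; rewrite /GRing.exp /=.
  exact: (differentiableM (differentiable_re k z) (differentiable_re k z)).
exact: (differentiableM (differentiable_im k z) (differentiable_im k z)).
Qed.

Lemma near_coord_neq0 k z : toC z 0 k != 0 -> \forall w \near z, toC w 0 k != 0.
Proof.
rewrite toC_neq0P => zk;
  have := differentiable_continuous (differentiable_nsq k z).
move=> /cvgrPdist_lt /(_ _ zk); apply: filterS => w H; rewrite toC_neq0P.
have := le_lt_trans (ler_norm _) H; rewrite /nsq; lra.
Qed.

Lemma toC_coord_neq0 z k : toC z 0 k != 0 -> z != 0.
Proof. by apply: contraNneq => ->; rewrite toC0 mxE. Qed.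

Lemma open_affine_dom k : open (chart_dom (affine_chart R k)).
Proof.
change (CP_open (chart_dom (affine_chart R k))).
rewrite /CP_open openE => z [zk /= z0].
have : toC z 0 k != 0 by apply/affine_domE.
move=> /near_coord_neq0; apply: filterS => w wk.
have w0 := toC_coord_neq0 wk.
by split => //; apply/(affine_domE _ w0).
Qed.

Lemma differentiable_row (n : nat) (f : realC R m -> 'rV[R]_n) z :
  (forall j, differentiable (fun w => f w 0 j) z) -> differentiable f z.
Proof.
move=> df.
have -> : f = \sum_j (fun w => f w 0 j *: delta_mx 0 j).
  by apply/funext => w; rewrite fct_sumE {1}[f w]row_sum_delta.
apply: differentiable_sum => j.
exact: (differentiableZl (delta_mx 0 j) (df j)).
Qed.

(** Near [z] the coordinates are quotients of real polynomials by [nsq k], the squared modulus of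
    the coordinate of index [k]. *)
Lemma differentiable_affine_coord k z : toC z 0 k != 0 ->
  differentiable (chart_coord (affine_chart R k) \o @cp_proj R m) z.
Proof.
move=> zk; pose re k (w : realC R m) : R := w.1 0 k;
  pose im k (w : realC R m) : R := w.2 0 k.
pose f (w : realC R m) : 'rV[R]_(m + m) := row_mx
  (\row_j ((re (lift k j) w * re k w + im (lift k j) w * im k w) / nsq k w))
  (\row_j ((im (lift k j) w * re k w - re (lift k j) w * im k w) / nsq k w)).
have fE : \forall w \near z,
  f w = (chart_coord (affine_chart R k) \o @cp_proj R m) w.
  apply: filterS (near_coord_neq0 zk) => w wk.
  rewrite /comp (affine_coordE _ (toC_coord_neq0 wk)).
  have n0 : nsq k w != 0 by rewrite gt_eqF // -toC_neq0P.
  have E i : toC w 0 (lift k i) / toC w 0 k =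
    ((re (lift k i) w * re k w + im (lift k i) w * im k w) / nsq k w +i*
    ((im (lift k i) w * re k w - re (lift k i) w * im k w) / nsq k w))%C.
    apply: (mulIf wk); rewrite divfK // /toC !mxE; apply/eqP;
      rewrite eq_complex /=.
    by apply/andP; split; apply/eqP; move: n0; rewrite /re /im /nsq => n0;
      field; exact: n0.
  by congr row_mx; apply/rowP => j; rewrite [RHS]mxE E [LHS]mxE.
apply: near_eq_differentiable fE _; apply: differentiable_row => j.
have dn : differentiable (fun w => (nsq k w)^-1) z.
  by apply: differentiableV => //; rewrite gt_eqF // -toC_neq0P.
have dr i : differentiable (re i) z by exact: differentiable_re.
have di i : differentiable (im i) z by exact: differentiable_im.
case: (split_ordP j) => i ->.
- under eq_fun do rewrite row_mxEl mxE.
  by apply: differentiableM dn; apply: differentiableD; apply: differentiableM.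
- under eq_fun do rewrite row_mxEr mxE.
  by apply: differentiableM dn; apply: differentiableB; apply: differentiableM.
Qed.

End Projective.

(** * The metric in terms of a lift *)

Lemma derive_comp (R : realType) (U V W : normedModType R) (g : U -> V)
    (f : V -> W) x v :
  differentiable g x -> differentiable f (g x) ->
  'D_v (f \o g) x = 'D_('D_v g x) f (g x).
Proof.
move=> dg df; rewrite (deriveE v (differentiable_comp dg df)) (diff_comp dg df).
by rewrite (deriveE _ df) (deriveE _ dg).
Qed.

Lemma derive_constant_line (R : realType) (V W : normedModType R) (f : V -> W)
    z v :
  (\forall h \near (0 : R), f (h *: v + z) = f z) -> 'D_v f z = 0.
Proof.
move=> fz; apply: cvg_lim => //.
apply: (@cvg_trans _ ((fun=> 0 : W) @ (0 : R)^')); last exact: cvg_cst.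
apply: near_eq_cvg; apply: cvg_within; apply: filterS fz => h hE.
by rewrite /= hE subrr scaler0.
Qed.

Section Metric.
Context {R : realType} {m : nat}.
Implicit Types (z w u v : realC R m) (a b : R) (p : CP R m) (k : 'I_m.+1).
Local Notation local_coord := (local_coordinates (@CP_atlas R m)).

Lemma exists_coord z : z != 0 -> exists k, toC z 0 k != 0.
Proof.
move=> z0; apply: contrapT => /forallNP H; have /eqP := z0; apply.
apply/eqP; rewrite -toC_eq0; apply/eqP/rowP => k.
by have /negP := H k; rewrite negbK => /eqP ->; rewrite mxE.
Qed.

(** Near [z] the map factors through an affine chart: it is the transition map, smooth by
    compatibility with the atlas, after the affine coordinates. *)
Lemma differentiable_coord_proj y z :
  local_coord y -> z != 0 -> chart_dom y (cp_proj z) ->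
  differentiable (chart_coord y \o @cp_proj R m) z.
Proof.
move=> [_ ly] z0 yz; have [k zk] := exists_coord z0.
have [_ sy] := ly _ (imageT (@affine_chart R m) k).
have kz : chart_dom (affine_chart R k) (cp_proj z) by apply/affine_domE.
have dy := smooth_differentiable sy
  (imageP (chart_coord (affine_chart R k)) (conj kz yz)).
have dk := differentiable_affine_coord zk.
apply: near_eq_differentiable (differentiable_comp dk dy).
apply: filterS (near_coord_neq0 zk) => w wk.
congr (chart_coord y _); apply: affine_paramK.
by apply/affine_domE => //; exact: toC_coord_neq0 wk.
Qed.

Lemma dproj_linear y z : local_coord y -> z != 0 -> chart_dom y (cp_proj z) ->
  linear (fun u => dproj z u y).
Proof.
move=> ly z0 yz a u v; have dy := differentiable_coord_proj ly z0 yz.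
by rewrite /dproj !(deriveE _ dy) linearP.
Qed.

(** [cp_proj] is constant along [(1 + h) z] for [h > -1] and along [(1 + ih) z] for every [h], both
    being nonzero multiples of [z]. *)
Lemma derive_proj_vertical (W : normedModType R) (g : CP R m -> W) z : z != 0 ->
  'D_z (g \o @cp_proj R m) z = 0 /\ 'D_(mulI z) (g \o @cp_proj R m) z = 0.
Proof.
move=> z0; split; apply: derive_constant_line.
  have : \forall h \near (0 : R), -1 < h by apply: lt_nbhsr; rewrite ltrN10.
  apply: filterS => h h1; congr (g _).
  have -> : h *: z + z = cmul (1 + h) (0 : R) z.
    by rewrite /cmul scale0r addr0 addrC scalerDl scale1r.
  apply: cp_proj_cmul; apply: cmul_neq0.
  by rewrite expr0n addr0 mulf_neq0 ?dot_eq0 // expf_eq0 /= gt_eqF //; lra.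
apply: (@filterE _ (nbhs (0 : R))) => h; congr (g _).
have -> : h *: mulI z + z = cmul 1%R h z by rewrite /cmul scale1r addrC.
apply: cp_proj_cmul; apply: cmul_neq0.
rewrite mulf_neq0 ?dot_eq0 // gt_eqF // expr1n.
by have := sqr_ge0 h; lra.
Qed.

Lemma cmul_linear a b : linear (@cmul R m a b).
Proof. by move=> t z w; rewrite cmulD cmulZ. Qed.

HB.instance Definition _ a b :=
  GRing.isLinear.Build _ _ _ _ (@cmul R m a b) (cmul_linear a b).

Lemma cmul_continuous a b : continuous (@cmul R m a b).
Proof.
move=> z; have h1 : (fun w : realC R m => a *: w) @ z --> a *: z.
  exact: scaler_continuous.
have h2 : (fun w : realC R m => b *: mulI w) @ z --> b *: mulI z.
  apply: (@continuous_comp _ _ _ (@mulI R m) (fun w : realC R m => b *: w)).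
    exact: mulI_continuous.
  exact: scaler_continuous.
exact: (cvgD h1 h2).
Qed.

Definition is_lift (x : chart R (m + m) (CP R m)) (q : 'rV[R]_(m + m))
    (E : 'rV[R]_(m + m) -> realC R m) : Prop :=
  differentiable E q /\
  \forall u \near q, E u != 0 /\ cp_proj (E u) = chart_param x u.

Section Point.
Variables (x : chart R (m + m) (CP R m)) (p : CP R m).
Hypotheses (lx : local_coord x) (xp : chart_dom x p).
Let q := chart_coord x p.

Let paramK : chart_param x q = p.
Proof. by have [[_ _ + _ _] _] := lx; apply; rewrite inE. Qed.

Section OneLift.
Variable E : 'rV[R]_(m + m) -> realC R m.
Hypothesis liftE : is_lift x q E.

Let dE : differentiable E q. Proof. by have [] := liftE. Qed.
Let Eq0 : E q != 0.
Proof. by have [_ /nbhs_singleton[]] := liftE. Qed.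
Let Eqp : cp_proj (E q) = p.
Proof. by have [_ /nbhs_singleton[_ ->]] := liftE. Qed.

Lemma coordinate_vector_lift i y : local_coord y -> chart_dom y p ->
  coordinate_vector x i p y = dproj (E q) ('D_(delta_mx 0 i) E q) y.
Proof.
move=> ly yp; rewrite /coordinate_vector /dproj -/q.
have dy : differentiable (chart_coord y \o @cp_proj R m) (E q).
  by apply: differentiable_coord_proj => //; rewrite Eqp.
rewrite -(derive_comp _ dE dy); apply: near_eq_derive.
by have [_] := liftE; apply: filterS => u [_ uE] /=; rewrite uE.
Qed.

(** Read in the chart [x] itself, the coordinate vector is a standard basis vector, yet it is also
    the image of this derivative under [dproj]. *)
Lemma derive_lift_neq0 i : 'D_(delta_mx 0 i) E q != 0.
Proof.
apply/eqP => E0; have := coordinate_vector_lift i lx xp.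
rewrite E0 /dproj derive0 /coordinate_vector -/q.
have [[_ oc coordK _ _] _] := lx.
have qc : (chart_coord x @` chart_dom x) q by exists p.
have H : \forall u \near q, u = (chart_coord x \o chart_param x) u.
  have := open_nbhs_nbhs (conj oc qc); apply: filterS => _ [p' xp' <-] /=.
  by rewrite coordK // inE.
rewrite -(near_eq_derive _ H) derive_id => /matrixP /(_ 0 i) /eqP.
by rewrite !mxE !eqxx oner_eq0.
Qed.

Hypothesis Eunit : E q = unit_rep p.

(** For unit [z], the orthogonal projection along the complex line of [z], that is, onto the
    horizontal space. *)
Definition hproj z w := w - (dot z w *: z + dot (mulI z) w *: mulI z).

Lemma hproj_horizontal z w : dot z z = 1 -> horizontal z (hproj z w).
Proof.
move=> z1; rewrite /horizontal /hproj !(dotDr, dotNr, dotZr) dot_mulII z1.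
by rewrite dot_mulIr dot_mulIxx; split; ring.
Qed.

Lemma dot_hproj z v w : dot z z = 1 -> dot (hproj z v) (hproj z w) = gram z v w.
Proof.
move=> z1; rewrite /hproj /gram !(dotDl, dotDr, dotNl, dotNr, dotZl, dotZr).
rewrite dot_mulII z1 (dotC v z) (dotC v (mulI z)) (dotC z (mulI z)) dot_mulIxx.
by ring.
Qed.

(** With [f] the coordinates of the projection, [E (f v)] spans the same complex line as [v] near
    [E q], so [gram (E (f v)) v w] vanishes there. Along [w] the map [E \o f] has derivative zero;
    as [w] is horizontal, the derivative of this [gram] at [E q] reduces to
    [dot (E q) (E q) * dot w w]. *)
Lemma horizontal_dproj_inj w : horizontal (E q) w -> dproj (E q) w x = 0 ->
  w = 0.
Proof.
move=> [w1 w2]; rewrite /dproj; set f := chart_coord x \o @cp_proj R m => fw.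
have xz : chart_dom x (cp_proj (E q)) by rewrite Eqp.
have df : differentiable f (E q) by exact: differentiable_coord_proj.
have fz : f (E q) = q by rewrite /f /= Eqp.
have dEf : differentiable E (f (E q)) by rewrite fz.
have ds : differentiable (E \o f) (E q) by exact: differentiable_comp df dEf.
have Ds : 'D_w (E \o f) (E q) = 0 by rewrite (derive_comp w df dEf) fw derive0.
have sE : (E \o f) (E q) = E q by rewrite /= fz.
pose s := E \o f; pose J (v : realC R m) := mulI (s v).
have [dJ DJ] := derive_linear (@mulI_continuous R m) ds.
have mulI0 : mulI (0 : realC R m) = 0 by congr (_, _); exact: oppr0.
have {}DJ : 'D_w J (E q) = 0
  by exact: etrans (DJ w) (etrans (congr1 (@mulI R m) Ds) mulI0).
have did : differentiable (fun v : realC R m => v) (E q) by exact: ex_diff.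
have Did : 'D_w (fun v : realC R m => v) (E q) = w by exact: derive_id.
have dcst : differentiable (fun _ : realC R m => w) (E q)
  by exact: differentiable_cst.
have Dcst : 'D_w (fun _ : realC R m => w) (E q) = 0 by exact: derive_cst.
have L (g h : realC R m -> realC R m) g' h' gz hz : differentiable g (E q) ->
    differentiable h (E q) -> 'D_w g (E q) = g' -> 'D_w h (E q) = h' ->
    g (E q) = gz -> h (E q) = hz ->
    is_derive (E q) w (fun v => dot (g v) (h v)) (dot g' hz + dot gz h').
  move=> dg dh <- <- <- <-;
    have [d D] := (leibniz_dot (realC R m)).2 _ _ _ dg dh.
  by rewrite -D; apply: derivableP; exact: diff_derivable.
have JE : J (E q) = mulI (E q) by rewrite /J /s sE.
have H1 := L _ _ _ _ _ _ ds ds Ds Ds sE sE.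
have H2 := L _ _ _ _ _ _ did dcst Did Dcst erefl erefl.
have H3 := L _ _ _ _ _ _ ds did Ds Did sE erefl.
have H4 := L _ _ _ _ _ _ ds dcst Ds Dcst sE erefl.
have H5 := L _ _ _ _ _ _ dJ did DJ Did JE erefl.
have H6 := L _ _ _ _ _ _ dJ dcst DJ Dcst JE erefl.
rewrite !(dot0l, dot0r, addr0, add0r, w1, w2) in H1 H2 H3 H4 H5 H6.
have HG := is_deriveB (is_deriveM H1 H2)
                      (is_deriveD (is_deriveM H3 H4) (is_deriveM H5 H6)).
rewrite !scaler0 !addr0 subr0 sE in HG.
have G0 : \forall v \near E q, gram (s v) v w = 0.
  have cf : {for E q, continuous f} by exact: differentiable_continuous.
  have nE : \forall u \near f (E q),
    E u != 0 /\ cp_proj (E u) = chart_param x u.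
    by rewrite fz; have [] := liftE.
  have [[ox _ coordK _ _] _] := lx.
  have nx : \forall v \near E q, chart_dom x (cp_proj v) /\ v != 0.
    have ox' : open (@cp_proj R m @^-1` chart_dom x `&` [set z | z != 0]) := ox.
    have Ez : (@cp_proj R m @^-1` chart_dom x `&` [set z | z != 0]) (E q)
      by split.
    exact: (open_nbhs_nbhs (conj ox' Ez)).
  have nf : \forall v \near E q,
      E (f v) != 0 /\ cp_proj (E (f v)) = chart_param x (f v) := cf _ nE.
  apply: filterS2 nf nx => v [sv0 svE] [xv v0].
  have : cp_proj v = cp_proj (s v) by rewrite svE coordK // inE.
  by move=> /(cp_proj_eqP v0 sv0)[a [b vE]]; have := gram_cmulr (s v) a b w;
    rewrite -vE.
have := etrans (esym (@derive_val _ _ _ _ _ _ _ HG)) (near_eq_derive w G0).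
rewrite derive_cst => /eqP; rewrite mulf_eq0 !dot_eq0 (negbTE Eq0) /=.
by move=> /eqP.
Qed.

(** The projection changes the derivative of the lift by vertical vectors, which [dproj] kills, so
    it meets the specification under [xget]; [horizontal_dproj_inj] makes it the only such
    vector. *)
Lemma horizontal_lift_coordinate i :
  horizontal_lift (E q) (coordinate_vector x i p) =
  hproj (E q) ('D_(delta_mx 0 i) E q).
Proof.
set v := 'D__ E q; set z := E q.
have z1 : dot z z = 1 by have [] := unit_repP p; rewrite /z Eunit.
have P y : local_coord y -> chart_dom y (cp_proj z) ->
    dproj z (hproj z v) y = coordinate_vector x i p y.
  move=> ly yz; have yp : chart_dom y p by rewrite -Eqp.
  rewrite (coordinate_vector_lift _ ly yp) -/z -/v.
  have [V1 V2] : dproj z z y = 0 /\ dproj z (mulI z) y = 0.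
    exact: derive_proj_vertical.
  have -> : hproj z v = (- dot z v) *: z + ((- dot (mulI z) v) *: mulI z + v).
    by rewrite /hproj !scaleNr addrA -opprD addrC.
  rewrite !(dproj_linear ly Eq0 yz).
  by rewrite V1 V2 !scaler0 !add0r.
apply: xget_unique; first by split=> //; exact: hproj_horizontal.
move=> u [hu Pu]; apply/eqP; rewrite -subr_eq0; apply/eqP.
have xz : chart_dom x (cp_proj z) by rewrite Eqp.
apply: horizontal_dproj_inj.
  have [h1 h2] := hu; have [g1 g2] := hproj_horizontal v z1.
  by split; rewrite dotDr dotNr ?h1 ?h2 ?g1 ?g2 subr0.
rewrite -scaleN1r addrC (dproj_linear lx Eq0 xz) (Pu _ lx xz) (P _ lx xz).
by rewrite scaleN1r addNr.
Qed.

Lemma fubini_study_unit_lift c i j :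
  fubini_study c p (coordinate_vector x i p) (coordinate_vector x j p) =
  4 / c * gram (E q) ('D_(delta_mx 0 i) E q) ('D_(delta_mx 0 j) E q).
Proof.
rewrite /fubini_study -Eunit !horizontal_lift_coordinate dot_hproj //.
by have [] := unit_repP p; rewrite Eunit.
Qed.

End OneLift.

(** The metric is computed at [unit_rep p], whereas [E q] is an arbitrary representative. A constant
    complex factor moves [E] to a lift through [unit_rep p], and [gram_cmul] supplies [t]. *)
Lemma fubini_study_lift E c : is_lift x q E -> exists2 t : R, t != 0 &
  forall i j,
    fubini_study c p (coordinate_vector x i p) (coordinate_vector x j p) =
    4 / c * (t * gram (E q) ('D_(delta_mx 0 i) E q) ('D_(delta_mx 0 j) E q)).
Proof.
move=> liftE; have [dE nE] := liftE.
have [q0 qp] := nbhs_singleton nE; rewrite paramK in qp.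
have [u1 up] := unit_repP p.
have u0 : unit_rep p != 0 by rewrite -dot_eq0 u1 oner_eq0.
have /(cp_proj_eqP u0 q0)[a [b uE]] : cp_proj (unit_rep p) = cp_proj (E q).
  by rewrite up qp.
have ab0 : a ^+ 2 + b ^+ 2 != 0.
  by apply/eqP => ab; have := u1; rewrite uE dot_cmul ab mul0r => /eqP;
    rewrite eq_sym oner_eq0.
have [dS DS] := derive_linear (L := @cmul R m a b) (@cmul_continuous a b) dE.
have liftS : is_lift x q (cmul a b \o E).
  split; first exact: dS.
  apply: filterS nE => y [y0 yE]; have Sy : cmul a b (E y) != 0.
    by apply: cmul_neq0; rewrite mulf_neq0 // dot_eq0.
  by split=> //=; rewrite cp_proj_cmul.
exists ((a ^+ 2 + b ^+ 2) ^+ 2); first by rewrite expf_neq0.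
move=> i j; rewrite (fubini_study_unit_lift liftS) //.
have DSi l : 'D_(delta_mx 0 l) (cmul a b \o E) q = cmul a b ('D_(delta_mx 0 l)
  E q).
  exact: DS.
by rewrite !DSi /= gram_cmul.
Qed.

End Point.
End Metric.

(** * Normalised lifts *)

Section SmoothVectors.
Context {R : realType}.

Let row_coord n (j : 'I_n) (u : 'rV[R]_n) : R := u 0 j.
Let row_coord_linear n (j : 'I_n) : linear (row_coord j).
Proof. by move=> a u v; rewrite /row_coord !mxE. Qed.
HB.instance Definition _ n (j : 'I_n) :=
  GRing.isLinear.Build _ _ _ _ (row_coord j) (row_coord_linear j).

Let scale_at (W : normedModType R) (w : W) (a : R) : W := a *: w.
Let scale_at_linear (W : normedModType R) (w : W) : linear (scale_at w).
Proof. by move=> a b c; rewrite /scale_at scalerDl scalerA. Qed.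
HB.instance Definition _ (W : normedModType R) (w : W) :=
  GRing.isLinear.Build _ _ _ _ (scale_at w) (scale_at_linear w).

Context {V : normedModType R} (U : set V) (oU : open U).

Lemma smooth_coord n (f : V -> 'rV[R]_n) j :
  smooth_on U f -> smooth_on U (fun x => f x 0 j).
Proof.
move=> sf; apply: (smooth_linear (L := row_coord j) oU _ sf).
exact: coord_continuous.
Qed.

Lemma smooth_scale_cst (W : normedModType R) (f : V -> R) (w : W) :
  smooth_on U f -> smooth_on U (fun x => f x *: w).
Proof.
move=> sf; apply: (smooth_linear (L := scale_at w) oU _ sf).
exact: scalel_continuous.
Qed.

Lemma smooth_opp (f : V -> R) : smooth_on U f -> smooth_on U (fun x => - f x).
Proof.
move=> sf; apply: (smooth_ext oU _ (smooth_mul oU (smooth_cst oU (-1 : R)) sf))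
  => x _.
by rewrite mulN1r.
Qed.

Lemma smooth_components m (f g : 'I_m.+1 -> V -> R) :
  (forall j, smooth_on U (f j)) -> (forall j, smooth_on U (g j)) ->
  smooth_on U (fun x => (\row_j f j x, \row_j g j x) : realC R m).
Proof.
move=> sf sg.
have s1 := smooth_sum oU (fun j => smooth_scale_cst ((delta_mx 0 j,
  0) : realC R m) (sf j)).
have s2 := smooth_sum oU (fun j => smooth_scale_cst ((0,
  delta_mx 0 j) : realC R m) (sg j)).
apply: (smooth_ext oU _ (smoothD oU s1 s2)) => x _.
have E1 : \sum_j f j x *: ((delta_mx 0 j, 0) : realC R m) = (\row_j f j x, 0).
  have P1 : {morph (fun v => (v, 0) : realC R m) : v w / v + w}.
    by move=> v w; congr (_, _); rewrite addr0.
  rewrite [in RHS](row_sum_delta (\row_j f j x)) (big_morph _ P1 (erefl _)).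
  by apply: eq_bigr => j _; congr (_, _); rewrite ?scaler0 // mxE.
have E2 : \sum_j g j x *: ((0, delta_mx 0 j) : realC R m) = (0, \row_j g j x).
  have P2 : {morph (fun v => (0, v) : realC R m) : v w / v + w}.
    by move=> v w; congr (_, _); rewrite addr0.
  rewrite [in RHS](row_sum_delta (\row_j g j x)) (big_morph _ P2 (erefl _)).
  by apply: eq_bigr => j _; congr (_, _); rewrite ?scaler0 // mxE.
by rewrite E1 E2; congr (_, _); rewrite ?addr0 ?add0r.
Qed.

Lemma smooth_cmul m (a b : V -> R) (F : V -> realC R m) :
  (forall j, smooth_on U (fun x => (F x).1 0 j)) ->
  (forall j, smooth_on U (fun x => (F x).2 0 j)) ->
  smooth_on U a -> smooth_on U b ->
    smooth_on U (fun x => cmul (a x) (b x) (F x)).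
Proof.
move=> s1 s2 sa sb.
have t1 j := smoothD oU (smooth_mul oU sa (s1 j)) (smooth_opp (smooth_mul oU sb
  (s2 j))).
have t2 j := smoothD oU (smooth_mul oU sa (s2 j)) (smooth_mul oU sb (s1 j)).
apply: (smooth_ext oU _ (smooth_components t1 t2)) => x _.
by congr (_, _); apply/rowP => j; rewrite !mxE ?mulrN.
Qed.

End SmoothVectors.

(** * Making the Hermitian product with a fixed vector constant *)

Section Normalisation.
Context {R : realType} {m : nat}.
Local Notation local_coord := (local_coordinates (@CP_atlas R m)).
Variables (x : chart R (m + m) (CP R m)) (p : CP R m).
Hypotheses (lx : local_coord x) (xp : chart_dom x p).
Let q := chart_coord x p.

(** The affine lift [F] of the coordinates is smooth because the transition map is. Multiplying it
    by [dot n n] divided by its Hermitian product with [n = F q] makes that product constant and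
    leaves the value at [q] unchanged. *)
Lemma exists_normalised_lift :
  exists (U : set 'rV[R]_(m + m)) (E : 'rV[R]_(m + m) -> realC R m),
    [/\ open U, U q, smooth_on U E,
        (forall u, U u -> exists2 p', chart_dom x p' & chart_coord x p' = u) &
        [/\ (forall u, U u -> is_lift x u E),
            (forall u, U u -> dot (E q) (E u) = dot (E q) (E q)) &
            (forall u, U u -> dot (mulI (E q)) (E u) = 0)]].
Proof.
have [[ox oc coordK _ cparam] tx] := lx.
have [z z0 zp] := cp_proj_surj p; have [k zk] := exists_coord z0.
pose a := affine_chart R k.
have ap : chart_dom a p by rewrite -zp; apply/affine_domE.
have [sx _] := tx _ (imageT (@affine_chart R m) k).
pose U0 := chart_coord x @` (chart_dom x `&` chart_dom a).
have {}sx : smooth_on U0 (chart_coord a \o chart_param x) := sx.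
(* Continuity of [chart_param x] pulls the open affine domain back to an open set of coordinates. *)
have oU0 : open U0.
  rewrite openE => _ [p' [xp' ap'] <-].
  have cx : (chart_coord x @` chart_dom x) (chart_coord x p') by exists p'.
  have K' : chart_param x (chart_coord x p') = p' by apply: coordK; rewrite inE.
  have cp := cparam _ (mem_set cx).
  have n1 : nbhs (chart_param x (chart_coord x p')) (chart_dom a).
    have oa : open_nbhs p' (chart_dom a) by split;
      [exact: open_affine_dom|exact: ap'].
    by rewrite K'; exact: open_nbhs_nbhs oa.
  have n2 : nbhs (chart_coord x p') (chart_param x @^-1` chart_dom a) :=
    cp _ n1.
  apply: filterS2 n2 (open_nbhs_nbhs (conj oc cx)) => y ay [p2 xp2 yE].
  exists p2 => //; split=> //.
  by move: ay; rewrite -yE /= coordK // inE.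
have U0q : U0 q by exists p.
pose h := chart_coord a \o chart_param x.
pose F u := affine_lift k (h u).
have sF1 j : smooth_on U0 (fun u => (F u).1 0 j).
  rewrite /F /affine_lift /=; case: (unliftP k j) => [i|] jE.
    apply: (smooth_ext oU0 _ (smooth_coord oU0 (lshift m i) sx)) => u _.
    by rewrite [RHS]mxE jE liftK [RHS]mxE.
  apply: (smooth_ext oU0 _ (smooth_cst oU0 (1 : R))) => u _.
  by rewrite [RHS]mxE jE unlift_none.
have sF2 j : smooth_on U0 (fun u => (F u).2 0 j).
  rewrite /F /affine_lift /=; case: (unliftP k j) => [i|] jE.
    apply: (smooth_ext oU0 _ (smooth_coord oU0 (rshift m i) sx)) => u _.
    by rewrite [RHS]mxE jE liftK [RHS]mxE.
  apply: (smooth_ext oU0 _ (smooth_cst oU0 (0 : R))) => u _.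
  by rewrite [RHS]mxE jE unlift_none.
have sF : smooth_on U0 F.
  apply: (smooth_ext oU0 _ (smooth_components oU0 sF1 sF2)) => u _.
  by congr (_, _); apply/rowP => j; rewrite !mxE.
have F0 u : F u != 0 by exact: affine_lift_neq0.
have FP u : U0 u -> cp_proj (F u) = chart_param x u.
  by move=> [p' [xp' ap'] <-]; rewrite /F /h /= coordK ?affine_paramK // inE.
(* [l1] and [l2] are the real and imaginary parts of the Hermitian product of [F u] with [n], and
   [rho] is its squared modulus. *)
pose n := F q; pose l1 u := dot n (F u); pose l2 u := dot (mulI n) (F u).
pose rho u := l1 u * l1 u + l2 u * l2 u.
have sl1 : smooth_on U0 l1.
  exact: (smooth_leibniz oU0 (leibniz_dot _) (smooth_cst oU0 n) sF).
have sl2 : smooth_on U0 l2.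
  exact: (smooth_leibniz oU0 (leibniz_dot _) (smooth_cst oU0 (mulI n)) sF).
have srho : smooth_on U0 rho.
  exact: (smoothD oU0 (smooth_mul oU0 sl1 sl1) (smooth_mul oU0 sl2 sl2)).
pose U := [set u | U0 u /\ rho u != 0].
have oU : open U.
  rewrite openE => u [U0u ru].
  have cr := differentiable_continuous (smooth_differentiable srho U0u).
  have r0 : 0 < `|rho u| by rewrite normr_gt0.
  have nr : \forall v \near u, `|rho u - rho v| < `|rho u|.
    by have /cvgrPdist_lt /(_ _ r0) := cr.
  apply: filterS2 nr (open_nbhs_nbhs (conj oU0 U0u)) => v rv U0v; split;
    first exact: U0v.
  by apply: contraTneq rv => ->; rewrite subr0 ltxx.
have UU0 : U `<=` U0 by move=> u [].
have nn0 : dot n n != 0 by rewrite dot_eq0; exact: F0.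
have l1q : l1 q = dot n n by [].
have l2q : l2 q = 0 by exact: dot_mulIxx.
have rq : rho q = dot n n * dot n n by rewrite /rho l1q l2q mulr0 addr0.
have Uq : U q by split; [exact: U0q|rewrite rq; exact: mulf_neq0].
have restr (W : normedModType R) (f : 'rV[R]_(m + m) -> W) :
  smooth_on U0 f -> smooth_on U f by exact: smooth_subset UU0.
pose t u := dot n n * (rho u)^-1.
have st : smooth_on U t.
  apply: (smooth_mul oU (smooth_cst oU (dot n n))).
  by apply: smooth_inv (restr _ _ srho) => // u [].
(* The conjugate of [l1 + i l2] times [dot n n / rho], that is, [dot n n] divided by [l1 + i l2]. *)
pose al u := t u * l1 u; pose be u := - (t u * l2 u).
have sal : smooth_on U al by exact: (smooth_mul oU st (restr _ _ sl1)).
have sbe : smooth_on U be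
  by exact: (smooth_opp oU (smooth_mul oU st (restr _ _ sl2))).
pose E u := cmul (al u) (be u) (F u).
have sE : smooth_on U E.
  exact: (smooth_cmul oU (fun j => restr _ _ (sF1 j)) (fun j => restr _ _ (sF2
    j)) sal sbe).
have abE u : U u -> al u ^+ 2 + be u ^+ 2 = t u ^+ 2 * rho u.
  by move=> _; rewrite /al /be /rho; ring.
have tr u : U u -> t u * rho u = dot n n by move=> [_ ru]; rewrite /t divfK.
have Eq : E q = n.
  have tq : t q = (dot n n)^-1 by rewrite /t rq invfM mulrA divff // mul1r.
  by rewrite /E /al /be l1q l2q tq mulr0 oppr0 mulVf // /cmul scale1r scale0r
    addr0.
have E0 u : U u -> E u != 0.
  move=> Uu; apply: cmul_neq0; rewrite abE //; have [_ ru] := Uu.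
  have t0 : t u != 0 by rewrite /t mulf_neq0 // invr_eq0.
  by rewrite mulf_neq0 ?dot_eq0 ?F0 // mulf_neq0 // expf_neq0.
exists U, E; split; [exact: oU|exact: Uq|exact: sE| |split].
- by move=> u [[p' [xp' _] <-] _]; exists p'.
- move=> u Uu; split; first exact: smooth_differentiable sE Uu.
  apply: filterS (open_nbhs_nbhs (conj oU Uu)) => v Uv; split; first exact: E0.
  by rewrite cp_proj_cmul; [apply: FP; exact: UU0|exact: E0].
- move=> u Uu; rewrite Eq /E /cmul dotDr !dotZr dot_mulIr -/(l1 u) -/(l2 u).
  by rewrite -(tr u Uu) /al /be /rho; ring.
- move=> u Uu; rewrite Eq /E /cmul dotDr !dotZr dot_mulII -/(l1 u) -/(l2 u).
  by rewrite /al /be; ring.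
Qed.

End Normalisation.

(** * Non-existence of orthogonal coordinates *)

Unset Implicit Arguments.

Theorem proposition3p1 (R : realType) (m : nat) (hm : (3 <= m)%N)
    (c : R) (hc : 0 < c) :
  ~ exists x : chart R (m + m) (CP R m),
      chart_dom x !=set0 /\
      orthogonal_coordinates (@CP_atlas R m) (fubini_study c) x.
Proof.
move=> [x [[p xp] [lx orth]]].
have [U [E [oU Uq sE xU [liftE EN EI]]]] := exists_normalised_lift lx xp.
have liftq := liftE _ Uq.
apply: (no_orthogonal_lift oU Uq sE hm _ EN EI).
- move=> u i j Uu ij; have [p' xp' uE] := xU _ Uu.
  have Lu : is_lift x (chart_coord x p') E by rewrite uE; exact: liftE.
  have [t t0 tE] := fubini_study_lift lx xp' c Lu.
  (* Cancelling the nonzero factors [4 / c] and [t] turns orthogonality at [p'] into the vanishing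
     of [gram] for the lift at [u]. *)
  have := orth p' xp' i j ij; rewrite tE uE !partialE => /eqP.
  rewrite !mulf_eq0 invr_eq0 (gt_eqF hc) (negbTE t0) pnatr_eq0 /=.
  by move=> /eqP.
- by have [_ /nbhs_singleton[]] := liftq.
- by move=> i; rewrite partialE; exact: (derive_lift_neq0 lx xp liftq).
Qed.
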